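(* Let $V\sim N(\mu,\gamma^2)$ with $\gamma>0$, let $\sigma>0$, and for $\kappa>0$ consider the equilibrium described in the context with penalty rate $c=\kappa\frac{\gamma}{\sigma}$. Then: 1. The ex-ante profit of the insider equals $$\mathcal W(\kappa):=\mathbb E[W_1^{\theta^*}]=\frac{\gamma\sigma}{2}\big(\kappa\log(\kappa\Lambda(\kappa))+2\Lambda(\kappa)\big).$$ Moreover, $\mathcal W$ is convex and decreasing in $\kappa$ and vanishes in the limit as $\kappa\to\infty$. 2. The derivative of $\Lambda$ is given by $$\Lambda'(\kappa)=-\frac{\Lambda^2(\kappa)}{1+\Lambda^2(\kappa)}.$$ 3. The total welfare, measuring the total expected profit of all traders, is given by $$\frac{\gamma\sigma}{2}\kappa\log(\kappa\Lambda(\kappa))=\frac{\gamma\sigma}{2}\kappa\log(1-\Lambda^2(\kappa)).$$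
   Context: For $\kappa>0$, $\Lambda(\kappa):=\frac{\sqrt{\kappa^2+4}-\kappa}{2}$. Let $B$ be a standard Brownian motion on $[0,1]$, $B_0=0$, independent of $V\sim N(\mu,\gamma^2)$, with expectation denoted $\mathbb E$. The equilibrium (of the continuous-time Kyle model with quadratic penalties at rate $c=\kappa\gamma/\sigma$) is as follows: the total demand $Y^*=\theta^*+\sigma B$ solves $$dY^*_t=\sigma\,dB_t+\alpha^*_t\,dt,\quad Y^*_0=0,\qquad \alpha^*_t=\Lambda(\kappa)\sigma\,\frac{\frac{V-\mu}{\gamma}-\frac{\Lambda(\kappa)Y^*_t}{\sigma}}{1-t\Lambda^2(\kappa)},$$ where $d\theta^*_t=\alpha^*_t\,dt$, $\theta^*_0=0$, is the insider's demand and $\sigma B$ the noise traders' demand; the price is $S_t=\lambda^*Y^*_t+\mu$ with $\lambda^*=\Lambda(\kappa)\frac{\gamma}{\sigma}$. The insider's terminal wealth is $W_1^{\theta^*}=\int_0^1(V-S_t)\alpha^*_t\,dt-\frac c2\int_0^1(\alpha^*_t)^2\,dt$; the noise traders' terminal wealth is $\sigma B_1(V-S_1)+\sigma\int_0^1B_t\,dS_t$. The total welfare is the sum of the expected terminal wealths of the insider and of the noise traders (the competitive market makers have zero expected profit). *)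

(* Defs.v *)
From HB Require Import structures.
From mathcomp Require Import all_boot all_order all_algebra.
From mathcomp Require Import all_classical all_reals all_analysis.

Set Implicit Arguments.
Unset Strict Implicit.
Unset Printing Implicit Defensive.

Import Order.TTheory GRing.Theory Num.Theory.
Import numFieldNormedType.Exports.

Local Open Scope classical_set_scope.
Local Open Scope ring_scope.

Section processes.
Context {d : measure_display} {T : measurableType d} {R : realType}.
Variable P : probability T R.

Implicit Types (X B : R -> T -> R) (V : T -> R) (F : R -> set (set T)).

Definition sigma_var (V : T -> R) : set (set T) :=
  preimage_set_system setT V measurable.

Definition sigma_process (D : set R) X : set (set T) :=
  <<s \bigcup_(t in D) sigma_var (X t) >>.

Definition independent_systems (G H : set (set T)) : Prop :=
  forall A C, G A -> H C -> P (A `&` C) = (P A * P C)%E.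

Definition continuous_paths X : Prop :=
  {ae P, forall w, {within `[0, 1], continuous (fun t => X t w)}}.

(* [normal_prob m s] takes the standard deviation [s], not the variance. *)
Definition is_normal V (m s : R) : Prop :=
  forall A, measurable A -> pushforward P V A = normal_prob m s A.

(* Time runs over [0, 1]; the values of [B] outside are irrelevant. *)
Definition brownian_motion (B : R -> {RV P >-> R}) : Prop :=
  [/\ {ae P, forall w, B 0 w = 0},
      forall s t, 0 <= s -> s < t -> t <= 1 ->
        independent_systems (sigma_process `[0, s] B)
                            (sigma_var (fun w => B t w - B s w)),
      forall s t, 0 <= s -> s < t -> t <= 1 ->
        is_normal (fun w => B t w - B s w) 0 (Num.sqrt (t - s))
    & continuous_paths B].

(* The filtration generated by the initial information [V] and by [B]; it is
   the smallest one to which the insider's strategy is adapted. *)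
Definition insider_filtration V B (t : R) : set (set T) :=
  <<s sigma_var V `|` \bigcup_(s in `[0, t]) sigma_var (B s) >>.

(* The elementary process equal to [e i] on [u i, u i.+1[ for i < n. *)
Definition elementary_process (n : nat) (u : nat -> R) (e : nat -> T -> R) :
    R -> T -> R :=
  fun s w => \sum_(i < n) e i w * \1_(`[u i, u i.+1[%classic) s.

Definition elementary_integral B (n : nat) (u : nat -> R)
    (e : nat -> T -> R) : T -> R :=
  fun w => \sum_(i < n) e i w * (B (u i.+1) w - B (u i) w).

Definition is_elementary F (b : R) (n : nat) (u : nat -> R)
    (e : nat -> T -> R) : Prop :=
  [/\ 0 <= u 0%N, forall i, (i < n)%N -> u i <= u i.+1, u n <= b
    & forall i, (i < n)%N ->
        sigma_var (e i) `<=` F (u i) /\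
        P.-integrable setT (fun w => ((e i w) ^+ 2)%:E)].

(* [J] is (a version of) the Ito integral of [H] against [B] over [0, b]: the
   L^2 limit of the integrals of elementary adapted processes that approximate
   [H] in L^2(dt x P). *)
Definition is_ito_integral F B (b : R) (H : R -> T -> R) (J : T -> R) : Prop :=
  measurable_fun setT J /\
  exists (n : nat -> nat) (u : nat -> nat -> R) (e : nat -> nat -> T -> R),
  [/\ forall k, is_elementary F b (n k) (u k) (e k),
      (fun k => \int[P]_w \int[lebesgue_measure]_(s in `[0%R, b])
          ((H s w - elementary_process (n k) (u k) (e k) s w) ^+ 2)%:E)%E
        @ \oo --> 0%E
    & (fun k => \int[P]_w
          ((J w - elementary_integral B (n k) (u k) (e k) w) ^+ 2)%:E)%E
        @ \oo --> 0%E].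

(* dX_t = a_t dt + v_t dB_t on [0, 1] *)
Definition is_ito_process F B (a v : R -> T -> R) X : Prop :=
  {ae P, forall w, lebesgue_measure.-integrable `[0, 1]
                     (fun s => (a s w)%:E)} /\
  forall t, 0 <= t <= 1 -> exists J, is_ito_integral F B t v J /\
    {ae P, forall w,
      X t w = X 0 w + Rintegral lebesgue_measure `[0, t] (a^~ w) + J w}.

(* [I] is (a version of) int_0^1 H_t dX_t, where dX_t = a_t dt + v_t dB_t. *)
Definition is_stochastic_integral F B (H a v X : R -> T -> R) (I : T -> R) :
    Prop :=
  [/\ is_ito_process F B a v X,
      measurable_fun setT I,
      {ae P, forall w, lebesgue_measure.-integrable `[0, 1]
                         (fun s => (H s w * a s w)%:E)}
    & exists J, is_ito_integral F B 1 (fun s w => H s w * v s w) J /\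
      {ae P, forall w, I w =
        Rintegral lebesgue_measure `[0, 1] (fun s => H s w * a s w) + J w}].

End processes.

Definition Lambda {R : realType} (kappa : R) : R :=
  (Num.sqrt (kappa ^+ 2 + 4) - kappa) / 2.

Section kyle.
Context {d : measure_display} {T : measurableType d} {R : realType}.
Variable P : probability T R.
Variables mu gamma sigma : R.
Variables (V : {RV P >-> R}) (B : R -> {RV P >-> R}).

Section fixed_penalty.
Variables (kappa : R) (Y : R -> {RV P >-> R}).

Definition penalty_rate : R := kappa * gamma / sigma.

Definition kyle_lambda : R := Lambda kappa * (gamma / sigma).

Definition trading_rate (t : R) (w : T) : R :=
  Lambda kappa * sigma *
  (((V w - mu) / gamma - Lambda kappa * Y t w / sigma) /
   (1 - t * Lambda kappa ^+ 2)).

Definition insider_demand (t : R) (w : T) : R :=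
  Rintegral lebesgue_measure `[0, t] (trading_rate ^~ w).

(* [Y] solves dY = sigma dB + trading_rate dt, Y_0 = 0; the noise being
   additive, the equation in integrated form involves no stochastic integral. *)
Definition is_equilibrium_demand : Prop :=
  continuous_paths P Y /\
  {ae P, forall w, forall t, 0 <= t <= 1 ->
     Y t w = insider_demand t w + sigma * B t w}.

Definition price (t : R) (w : T) : R := kyle_lambda * Y t w + mu.

Definition insider_wealth (w : T) : R :=
  Rintegral lebesgue_measure `[0, 1]
    (fun t => (V w - price t w) * trading_rate t w) -
  penalty_rate / 2 *
  Rintegral lebesgue_measure `[0, 1] (fun t => trading_rate t w ^+ 2).

(* [I] is (a version of) int_0^1 B_t dS_t, the price S having the dynamics
   dS_t = lambda alpha_t dt + lambda sigma dB_t. *)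
Definition is_noise_gain (I : T -> R) : Prop :=
  is_stochastic_integral P (insider_filtration V B) B B
    (fun t w => kyle_lambda * trading_rate t w)
    (fun _ _ => kyle_lambda * sigma)
    price I.

(* [I] stands for int_0^1 B_t dS_t. *)
Definition noise_wealth (I : T -> R) (w : T) : R :=
  sigma * B 1 w * (V w - price 1 w) + sigma * I w.

End fixed_penalty.

Definition ex_ante_profit (Y : R -> R -> {RV P >-> R}) (kappa : R) : R :=
  fine 'E_P[insider_wealth kappa (Y kappa)].

End kyle.

(* Main.v *)
(* Write L = Lambda kappa, so that L ^ 2 + kappa L = 1, and Z = (V - mu) / gamma.
   The process M_t = (Z - L Y_t / sigma) / (1 - t L ^ 2) equals Z minus the
   Wiener integral of L / (1 - s L ^ 2) over [0, t]. An integration by parts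
   writes that integral path by path, as psi(t) B_t - int_0^t psi'(s) B_s ds with
   psi(s) = L / (1 - s L ^ 2), and Fubini's theorem gives
   E[M_t ^ 2] = 1 / (1 - t L ^ 2) and E[B_t M_t] = ln (1 - t L ^ 2) / L.
   Since alpha_t = L sigma M_t and V - S_t = gamma (1 - t L ^ 2) M_t, integrating
   over t yields the expected wealths; the Ito part of int B dS has mean zero,
   being an L^2 limit of sums of adapted factors times independent increments.

   The profit is monotone and convex because it is, up to a constant factor, the
   maximum over l of kappa ln (1 - l ^ 2) + 2 l, which is affine in kappa; this
   only uses ln x <= x - 1. *)

Require Import Defs.
From HB Require Import structures.
From mathcomp Require Import all_boot all_order all_algebra.
From mathcomp Require Import all_classical all_reals all_analysis.
From mathcomp Require Import measurable_realfun.
From mathcomp Require Import ring lra.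

Set Implicit Arguments.
Unset Strict Implicit.
Unset Printing Implicit Defensive.

Import Order.TTheory GRing.Theory Num.Theory.
Import numFieldNormedType.Exports.

Local Open Scope classical_set_scope.
Local Open Scope ring_scope.

(** * Lambda and the profit function *)

Section calculus.
Context {R : realType}.
Implicit Types k x y : R.

(** No Wiener integral is constructed for M. Along each regular path of any solution Y, the quotient
    (Z - L^2 int_0^t M) / (1 - t L^2) is differentiable in t, and the equilibrium equation turns its
    derivative into psi'(t) B_t; this alone yields the explicit form of M. The obstacle is
    measurability: paths are regular only almost surely, and the wealths are path integrals that are
    not known to be measurable. Hence an integral comparison blind to null sets and to
    measurability, and processes cut off to a good set and frozen outside of [0, 1], to which Fubini
    applies. Normal moments come from comparing two normal densities through 1 + x <= exp x: a shift
    gives the mean, a scaling the variance. The welfare claim ranges over all versions of int B dS.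
    That one exists rests on int_0^1 B dB = (B_1^2 - 1) / 2, that is, on L^2 convergence of the sums
    of squared increments, for which a fourth moment bound of order (t - s)^2 suffices. The
    insider's expected trading gain gamma sigma L is exactly the noise traders' expected loss, so
    the welfare is minus the expected penalty. *)

Lemma Lambda_quadratic k : Lambda k ^+ 2 + k * Lambda k = 1.
Proof.
rewrite /Lambda; set s := Num.sqrt _.
have : s ^+ 2 = k ^+ 2 + 4 by rewrite sqr_sqrtr// addr_ge0// sqr_ge0.
move=> h; transitivity ((s ^+ 2 - k ^+ 2) / 4); first by field.
by rewrite h; field.
Qed.

Lemma Lambda_gt0 k : 0 < Lambda k.
Proof.
rewrite divr_gt0// subr_gt0 (le_lt_trans (ler_norm k))// -sqrtr_sqr ltr_sqrt.
  by rewrite ltrDl.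
by rewrite ltr_pwDr// sqr_ge0.
Qed.

Lemma sub_sqr_Lambda k : 1 - Lambda k ^+ 2 = k * Lambda k.
Proof. by rewrite -(Lambda_quadratic k); ring. Qed.

Lemma sqr_Lambda_lt1 k : 0 < k -> Lambda k ^+ 2 < 1.
Proof. by move=> k0; rewrite -subr_gt0 sub_sqr_Lambda mulr_gt0// Lambda_gt0. Qed.

Lemma Lambda_le_inv k : 0 < k -> Lambda k <= k^-1.
Proof.
move=> k0; rewrite -[leRHS]mul1r ler_pdivlMr// mulrC -sub_sqr_Lambda.
by rewrite gerBl sqr_ge0.
Qed.

Lemma is_derive_Lambda k : 0 < k ->
  is_derive k 1 (Lambda : R -> R) (- (Lambda k ^+ 2 / (1 + Lambda k ^+ 2))).
Proof.
move=> k0.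
have k4 : 0 < k ^+ 2 + 4 by rewrite ltr_pwDr// sqr_ge0.
have s0 : 0 < Num.sqrt (k ^+ 2 + 4) by rewrite sqrtr_gt0.
have h : is_derive k 1 (fun x : R => x ^+ 2 + 4) (2 * k).
  by apply: is_derive_eq; rewrite !scaler1; ring.
have h2 : is_derive (k ^+ 2 + 4) 1 (@Num.sqrt R)
    (2 * Num.sqrt (k ^+ 2 + 4))^-1 by exact: is_derive1_sqrt.
have h3 : is_derive k 1 (fun x : R => Num.sqrt (x ^+ 2 + 4))
    ((2 * Num.sqrt (k ^+ 2 + 4))^-1 * (2 * k)).
  exact: (@is_derive1_comp _ (@Num.sqrt R) (fun x : R => x ^+ 2 + 4)).
have h4 : is_derive k 1 (Lambda : R -> R)
    (((2 * Num.sqrt (k ^+ 2 + 4))^-1 * (2 * k) - 1) * 2^-1).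
  have -> : (Lambda : R -> R) =
      (fun x => 2^-1 *: (Num.sqrt (x ^+ 2 + 4) - x)).
    by apply/funext => x; rewrite /Lambda mulrC.
  have h5 := is_deriveZ (2^-1) (is_deriveB h3 (is_derive_id k 1)).
  by rewrite mulrC; exact: h5.
apply: is_derive_eq.
(* Eliminating the root, and writing 1 + L^2 = L (2 L + k), turns the claim into an identity of
   rational functions of L and k. *)
have -> : Num.sqrt (k ^+ 2 + 4) = 2 * Lambda k + k.
  by rewrite /Lambda mulrC divfK ?subrK// pnatr_eq0.
have -> : 1 + Lambda k ^+ 2 = Lambda k * (2 * Lambda k + k).
  by rewrite -[X in X + _](Lambda_quadratic k); ring.
have L0 := Lambda_gt0 k.
by field; rewrite !gt_eqF//; lra.
Qed.

(* The profit is a maximum over l of functions affine in k, attained at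
   [l = Lambda k]: the insider optimises against a fixed penalty rate. *)
Definition profit k : R := k * ln (k * Lambda k) + 2 * Lambda k.

Lemma profitE k : profit k = k * ln (1 - Lambda k ^+ 2) + 2 * Lambda k.
Proof. by rewrite /profit sub_sqr_Lambda. Qed.

(** With a = 1 - l^2 and b = 1 - L^2 = k L, the bound ln (a / b) <= a / b - 1 gives k (ln a - ln b)
    <= (a - b) / L. The room left below 2 (L - l) is the square (L - l)^2, divided by L. *)
Lemma profit_ge k l : 0 < k -> l ^+ 2 < 1 ->
  k * ln (1 - l ^+ 2) + 2 * l <= profit k.
Proof.
move=> k0 l1; rewrite profitE.
have L0 := Lambda_gt0 k; have LE := sub_sqr_Lambda k.
have p1 : 0 < 1 - l ^+ 2 by rewrite subr_gt0.
have p2 : 0 < 1 - Lambda k ^+ 2 by rewrite subr_gt0 sqr_Lambda_lt1.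
set a := 1 - l ^+ 2 in p1 *; set b := 1 - Lambda k ^+ 2 in p2 LE *.
have : ln (a / b) <= a / b - 1.
  by have := @le_ln1Dx R (a / b - 1); rewrite ltrBrDl subrr addrC subrK divr_gt0//; apply.
rewrite ln_div ?posrE// => h.
have : k * (ln a - ln b) <= k * (a / b - 1) by rewrite ler_pM2l.
have -> : k * (a / b - 1) = (a - b) / Lambda k.
  by rewrite LE; field; rewrite !gt_eqF.
move=> {}h.
have : (a - b) / Lambda k <= 2 * (Lambda k - l).
  rewrite ler_pdivrMr// -subr_ge0 /a /b.
  have -> : 2 * (Lambda k - l) * Lambda k - (1 - l ^+ 2 - (1 - Lambda k ^+ 2))
    = (Lambda k - l) ^+ 2 by ring.
  exact: sqr_ge0.
lra.
Qed.

(** The affine function for l = [Lambda k2] touches the profit at [k2] and has slope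
    [ln (1 - l ^+ 2)], which is negative. Its value at [k1] is therefore larger, and [profit k1]
    dominates that value. *)
Lemma profit_decreasing k1 k2 : 0 < k1 -> k1 < k2 -> profit k2 < profit k1.
Proof.
move=> k1_gt0 k12; have k2_gt0 := lt_trans k1_gt0 k12.
have L1 := sqr_Lambda_lt1 k2_gt0.
apply: lt_le_trans (profit_ge k1_gt0 L1).
rewrite profitE ltrD2r ltr_nM2r// ln_lt0// subr_gt0 L1/=.
by rewrite gtrBl exprn_gt0// Lambda_gt0.
Qed.

(** The supporting line at the intermediate point z, the affine function for l = [Lambda z], lies
    below the profit at x and at y, and its values there average to [profit z]. *)
Lemma profit_convex (t : R) x y : 0 <= t -> t <= 1 -> 0 < x -> 0 < y ->
  profit (t * x + (1 - t) * y) <= t * profit x + (1 - t) * profit y.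
Proof.
move=> t0 t1 x0 y0.
set z := t * x + (1 - t) * y.
have z0 : 0 < z.
  rewrite /z; have [->|tn0] := eqVneq t 0; first by rewrite mul0r add0r subr0 mul1r.
  have : 0 < t * x by rewrite mulr_gt0// lt0r tn0.
  have : 0 <= (1 - t) * y by rewrite mulr_ge0 ?subr_ge0// ltW.
  lra.
have hx := profit_ge x0 (sqr_Lambda_lt1 z0).
have hy := profit_ge y0 (sqr_Lambda_lt1 z0).
have hx' := ler_wpM2l t0 hx.
have t1' : 0 <= 1 - t by rewrite subr_ge0.
have hy' := ler_wpM2l t1' hy.
apply: le_trans (lerD hx' hy'); rewrite profitE.
by set a := ln _; set b := Lambda z; rewrite /z le_eqVlt; apply/orP; left; apply/eqP; ring.
Qed.

(** Squeeze bound for the limit at infinity: dropping the nonpositive logarithm leaves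
    [2 * Lambda k], and [Lambda k <= k^-1]. *)
Lemma profit_bound k : 0 < k -> `|profit k| <= 2 * k^-1.
Proof.
move=> k0; have L0 := Lambda_gt0 k.
rewrite ler_norml; apply/andP; split.
  (* comparing with [l = 0] *)
  have := @profit_ge k 0 k0; rewrite expr0n/= subr0 ln1 !mulr0 addr0 => h.
  have : 0 <= k^-1 by rewrite invr_ge0 ltW.
  by have := h ltr01; lra.
rewrite profitE.
have h : ln (1 - Lambda k ^+ 2) <= 0 by rewrite ln_le0// gerBl sqr_ge0.
have := mulr_ge0_le0 (ltW k0) h.
have := Lambda_le_inv k0; lra.
Qed.

Lemma profit_cvg0 : profit k @[k --> +oo] --> (0 : R).
Proof.
apply: norm_cvg0.
apply: (@squeeze_cvgr _ _ _ _ (fun=> 0) (fun k => 2 * k^-1)).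
- by near do rewrite normr_ge0/= profit_bound//.
- exact: cvg_cst.
- rewrite -[X in _ --> X](mulr0 2); apply: cvgM; first exact: cvg_cst.
  apply/gtr0_cvgV0; last exact: cvg_id.
  near=> k; near: k; exact: nbhs_pinfty_gt.
Unshelve. all: by end_near. Qed.

End calculus.

(** * Integrals on a probability space *)

Section ae_integral.
Context {d : measure_display} {T : measurableType d} {R : realType}.
Variable m : {measure set T -> \bar R}.
Local Open Scope ereal_scope.
Import HBNNSimple.

(* No measurability is needed: the integral is a supremum over simple
   functions, which can be cut off outside of a negligible set. *)
Lemma ge0_ae_le_integralT (f g : T -> \bar R) :
  (forall x, 0 <= f x) -> (forall x, 0 <= g x) ->
  {ae m, forall x, f x = g x} -> \int[m]_x f x <= \int[m]_x g x.
Proof.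
move=> f0 g0 [N [mN N0 fgN]].
rewrite (ge0_integralTE _ f0); apply: ge_ereal_sup => _ [h /= hf <-].
have mNC := measurableC mN.
pose h' := proj_nnsfun h mNC.
have -> : sintegral m h = sintegral m h'.
  rewrite -!integralT_nnsfun; apply: ae_eq_integral => //.
  - exact/measurable_EFinP.
  - exact/measurable_EFinP.
  - exists N; split=> // x /=; apply: contra_notP => Nx _.
    by rewrite /h' /= mindicE mem_set//= mulr1.
rewrite (ge0_integralTE _ g0); apply: ereal_sup_ubound; exists h' => //= x.
rewrite mindicE; have [Nx|Nx] := pselect (N x).
  by rewrite memNset ?mulr0//= => /(_ Nx).
rewrite mem_set//= mulr1; suff <- : f x = g x by [].
by apply: contrapT => h1; apply/Nx/fgN.
Qed.

(** Used to replace the wealths, whose measurability is not known, by measurable expressions in the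
    cut-off processes. *)
Lemma ae_eq_integralT (f g : T -> \bar R) :
  {ae m, forall x, f x = g x} -> \int[m]_x f x = \int[m]_x g x.
Proof.
move=> fg; have gf : {ae m, forall x, g x = f x}.
  by apply: filterS fg => x ->.
rewrite integralE [RHS]integralE; congr (_ - _); apply/eqP; rewrite eq_le;
  apply/andP; split; apply: ge0_ae_le_integralT => //;
  [apply: filterS fg|apply: filterS gf|apply: filterS fg|apply: filterS gf];
  by move=> x; rewrite ?(funeposE, funenegE) => ->.
Qed.

Lemma ae_eq_integral_set (D : set T) (f g : T -> \bar R) : measurable D ->
  {ae m, forall x, D x -> f x = g x} ->
  \int[m]_(x in D) f x = \int[m]_(x in D) g x.
Proof.
move=> mD fg; rewrite integral_mkcond [RHS]integral_mkcond.
apply: ae_eq_integralT; apply: filterS fg => x fgx.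
by rewrite !patchE; case: ifPn => // /set_mem/fgx.
Qed.

End ae_integral.

Section real_integrable.
Context {d : measure_display} {T : measurableType d} {R : realType}.
Variables (m : {measure set T -> \bar R}) (D : set T).
Hypothesis mD : measurable D.
Implicit Types X Y : T -> R.

Lemma integrable_EFinD X Y : m.-integrable D (EFin \o X) ->
  m.-integrable D (EFin \o Y) ->
  m.-integrable D (EFin \o (fun w => X w + Y w)).
Proof.
move=> iX iY; have := integrableD mD iX iY.
by apply: eq_integrable => // w _ /=; rewrite EFinD.
Qed.

Lemma integrable_EFinZ (c : R) X : m.-integrable D (EFin \o X) ->
  m.-integrable D (EFin \o (fun w => c * X w)).
Proof.
move=> iX; have := integrableZl mD c iX.
by apply: eq_integrable => // w _ /=; rewrite EFinM.
Qed.

Lemma integrable_EFinB X Y : m.-integrable D (EFin \o X) ->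
  m.-integrable D (EFin \o Y) ->
  m.-integrable D (EFin \o (fun w => X w - Y w)).
Proof.
move=> iX iY; have := integrableB mD iX iY.
by apply: eq_integrable => // w _ /=; rewrite EFinB.
Qed.

Lemma integrable_EFin_le X Y : measurable_fun D X ->
  m.-integrable D (EFin \o Y) -> (forall w, `|X w| <= Y w) ->
  m.-integrable D (EFin \o X).
Proof.
move=> mX iY XY; apply: (le_integrable _ _ _ iY) => //.
  exact/measurable_EFinP.
by move=> w _ /=; rewrite lee_fin (le_trans (XY w))// ler_norm.
Qed.

Lemma integrable_EFin_fin X : m.-integrable D (EFin \o X) ->
  (\int[m]_(w in D) (X w)%:E)%E = (\int[m]_(w in D) X w)%:E.
Proof. by move=> iX; rewrite fineK//; exact: integrable_fin_num. Qed.

End real_integrable.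

Section square_integrable.
Context {d : measure_display} {T : measurableType d} {R : realType}.
Variable P : probability T R.
Implicit Types X Y : T -> R.

Lemma Rintegral_probability_cst (c : R) : \int[P]_w c = c.
Proof.
rewrite Rintegral_cst// [X in fine X](_ : _ = 1%E) ?mulr1//.
exact: probability_setT.
Qed.

Definition sq_integrable X :=
  measurable_fun setT X /\ P.-integrable setT (fun w => (X w ^+ 2)%:E).

Lemma sq_integrable_mfun X : sq_integrable X -> measurable_fun setT X.
Proof. by case. Qed.

Lemma integrable_sqrD X Y : sq_integrable X -> sq_integrable Y ->
  P.-integrable setT (EFin \o (fun w => X w ^+ 2 + Y w ^+ 2)).
Proof. by move=> [mX iX] [mY iY]; exact: integrable_EFinD. Qed.

Lemma sq_integrableM X Y : sq_integrable X -> sq_integrable Y ->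
  P.-integrable setT (EFin \o (fun w => X w * Y w)).
Proof.
move=> sX sY; apply: (integrable_EFin_le _ _ (integrable_sqrD sX sY)) => //.
  by apply: measurable_funM; [case: sX|case: sY].
move=> w; rewrite normrM -(real_normK (num_real (X w))).
rewrite -[X in _ <= _ + X](real_normK (num_real (Y w))).
have := sqr_ge0 (`|X w| - `|Y w|); have := mulr_ge0 (normr_ge0 (X w)) (normr_ge0 (Y w)).
nra.
Qed.

Lemma sq_integrable_cst (c : R) : sq_integrable (cst c).
Proof. by split => //; exact: (finite_measure_integrable_cst P (c ^+ 2)). Qed.

Lemma sq_integrable_integrable X : sq_integrable X ->
  P.-integrable setT (EFin \o X).
Proof.
move=> sX; have := sq_integrableM sX (sq_integrable_cst 1).
by apply: eq_integrable => // w _ /=; rewrite mulr1.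
Qed.

Lemma sq_integrableZ (c : R) X : sq_integrable X ->
  sq_integrable (fun w => c * X w).
Proof.
move=> [mX iX]; split; first exact: measurable_funM.
under eq_fun do rewrite exprMn.
exact: integrable_EFinZ.
Qed.

Lemma sq_integrableD X Y : sq_integrable X -> sq_integrable Y ->
  sq_integrable (fun w => X w + Y w).
Proof.
move=> sX sY; have mXY : measurable_fun setT (fun w => X w + Y w).
  by apply: measurable_funD; [case: sX|case: sY].
split => //.
apply: (@integrable_EFin_le _ _ _ _ _ _ _ (fun w => 2 * (X w ^+ 2 + Y w ^+ 2))).
- exact: measurableT.
- exact: (measurable_funX 2 mXY).
- exact/integrable_EFinZ/integrable_sqrD.
- move=> w; rewrite ger0_norm ?sqr_ge0//.
  by have := sqr_ge0 (X w - Y w); nra.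
Qed.

Lemma sq_integrableN X : sq_integrable X -> sq_integrable (fun w => - X w).
Proof.
move=> /(sq_integrableZ (-1)).
by under eq_fun do rewrite mulN1r.
Qed.

Lemma sq_integrableB X Y : sq_integrable X -> sq_integrable Y ->
  sq_integrable (fun w => X w - Y w).
Proof. by move=> sX sY; apply: sq_integrableD => //; exact: sq_integrableN. Qed.

Lemma sq_integrable_ae X Y : measurable_fun setT Y ->
  {ae P, forall w, X w = Y w} -> sq_integrable X -> sq_integrable Y.
Proof.
move=> mY XY [mX /integrableP[_ iX]]; split => //; apply/integrableP; split.
  by apply/measurable_EFinP; exact: measurable_funX.
rewrite (@ae_eq_integralT _ _ _ _ _ (fun w => `|(X w ^+ 2)%:E|%E))//.
by apply: filterS XY => w ->.
Qed.

Lemma eq_Rintegral_ae X Y : {ae P, forall w, X w = Y w} ->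
  \int[P]_w X w = \int[P]_w Y w.
Proof. by move=> XY; congr fine; apply: ae_eq_integralT; apply: filterS XY => w ->. Qed.

(** The variance is nonnegative: expand the integral of [(X w - c) ^+ 2] for c the mean of X. *)
Lemma sqr_Rintegral_le X : sq_integrable X ->
  (\int[P]_w X w) ^+ 2 <= \int[P]_w (X w ^+ 2).
Proof.
move=> sX; set c := Rintegral _ _ _.
have h : 0 <= \int[P]_w ((X w - c) ^+ 2).
  by apply: Rintegral_ge0 => w _; exact: sqr_ge0.
have iX := sq_integrable_integrable sX.
have iX2 : P.-integrable setT (EFin \o (fun w => X w ^+ 2)) by case: sX.
move: h.
have -> : (fun w => (X w - c) ^+ 2) =
    (fun w => X w ^+ 2 + ((- 2 * c) * X w + c ^+ 2)).
  by apply/funext => w; ring.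
have ic : P.-integrable setT (EFin \o (fun=> c ^+ 2)).
  exact: (finite_measure_integrable_cst P (c ^+ 2)).
have icX : P.-integrable setT (EFin \o (fun w => - 2 * c * X w)).
  exact: integrable_EFinZ.
rewrite RintegralD//; last exact: integrable_EFinD.
rewrite RintegralD//.
rewrite RintegralZl// Rintegral_probability_cst -/c.
nra.
Qed.

End square_integrable.

(** * Independence *)

Section independent_product.
Context {d : measure_display} {T : measurableType d} {R : realType}.
Variable P : probability T R.
Variables X Y : T -> R.
Hypotheses (mX : measurable_fun setT X) (mY : measurable_fun setT Y).
Hypothesis XY : independent_systems P (sigma_var X) (sigma_var Y).
Local Open Scope ereal_scope.

Let rX : {RV P >-> R} := HB.pack X (isMeasurableFun.Build _ _ _ _ _ mX).
Let rY : {RV P >-> R} := HB.pack Y (isMeasurableFun.Build _ _ _ _ _ mY).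

Let mp : measurable_fun setT (fun w => (X w, Y w)).
Proof. exact: measurable_fun_pair. Qed.

Let rp : {RV P >-> (R * R)%type} :=
  HB.pack (fun w => (X w, Y w)) (isMeasurableFun.Build _ _ _ _ _ mp).

(** Uniqueness of the product measure reduces the claim to rectangles, where it is the independence
    hypothesis. *)
Let joint_law (A : set (R * R)) : measurable A ->
  (distribution P rX \x distribution P rY) A = distribution P rp A.
Proof.
apply: product_measure_unique => A1 A2 mA1 mA2.
rewrite /distribution /pushforward/= -XY.
- by congr (P _); apply/seteqP; split.
- by exists A1 => //; rewrite setTI.
- by exists A2 => //; rewrite setTI.
Qed.

Let ge0_integral_pair (f : R * R -> \bar R) :
  measurable_fun setT f -> (forall z, 0 <= f z) ->
  \int[P]_w f (X w, Y w) =
  \int[distribution P rX]_x \int[distribution P rY]_y f (x, y).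
Proof.
move=> mf f0; rewrite -fubini_tonelli1//.
rewrite (eq_measure_integral (distribution P rp)); last first.
  by move=> A mA _; exact: joint_law.
by rewrite ge0_integral_distribution.
Qed.

Hypotheses (iX : P.-integrable setT (EFin \o X))
  (iY : P.-integrable setT (EFin \o Y)).

Let mmul : measurable_fun setT (fun z : R * R => (z.1 * z.2)%:E).
Proof. by apply/measurable_EFinP; exact: measurable_funM. Qed.

Let integral_normX : \int[distribution P rX]_x `|x%:E| < +oo.
Proof.
rewrite ge0_integral_distribution//; last exact: measurableT_comp.
by case/integrableP: iX.
Qed.

Let integral_normY : \int[distribution P rY]_x `|x%:E| < +oo.
Proof.
rewrite ge0_integral_distribution//; last exact: measurableT_comp.
by case/integrableP: iY.
Qed.

Let integrable_mul_prod :
  (distribution P rX \x distribution P rY).-integrable setT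
     (fun z => (z.1 * z.2)%:E).
Proof.
apply/integrable12ltyP => //.
rewrite (eq_integral (fun x : R => `|x%:E| *
    \int[distribution P rY]_y `|y%:E|)); last first.
  move=> x _; rewrite -ge0_integralZl//; last exact: measurableT_comp.
  by apply: eq_integral => y _; rewrite -abseM -EFinM.
rewrite ge0_integralZr//.
- by rewrite lte_mul_pinfty// ?integral_ge0// ge0_fin_numE ?integral_ge0.
- exact: measurableT_comp.
- exact: integral_ge0.
Qed.

Lemma independent_integrableM :
  P.-integrable setT (EFin \o (fun w => X w * Y w)%R).
Proof.
apply/integrableP; split.
  by apply/measurable_EFinP; exact: measurable_funM.
have /(integrable12ltyP _ _ mmul) := integrable_mul_prod.
suff <- : \int[P]_w `|(X w * Y w)%:E| =
    \int[distribution P rX]_x \int[distribution P rY]_y `|(x * y)%:E| by [].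
apply: (@ge0_integral_pair (fun z => `|(z.1 * z.2)%:E|)) => //.
exact: measurableT_comp.
Qed.

(** Fubini for the joint law of X and Y, which is the product of their laws. *)
Lemma independent_RintegralM :
  (\int[P]_w (X w * Y w) = \int[P]_w X w * \int[P]_w Y w)%R.
Proof.
have iXY := independent_integrableM.
rewrite {1}/Rintegral.
have -> : \int[P]_w (X w * Y w)%:E =
    \int[distribution P rp]_z (z.1 * z.2)%:E.
  by rewrite integral_distribution.
rewrite (eq_measure_integral (distribution P rX \x distribution P rY)); last first.
  by move=> A mA _; apply: esym; exact: joint_law.
rewrite -integral12_prod_meas1//.
have iY' : (distribution P rY).-integrable setT EFin.
  by apply: integrable_pushforward.
have iX' : (distribution P rX).-integrable setT EFin.
  by apply: integrable_pushforward.
rewrite /fubini_F/=.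
rewrite (eq_integral (fun x : R => x%:E *
    \int[distribution P rY]_y y%:E)); last first.
  by move=> x _; rewrite -integralZl//; apply: eq_integral => y _; rewrite EFinM.
have EY : \int[distribution P rY]_y y%:E = (\int[P]_w Y w)%:E.
  by rewrite integral_distribution// -integrable_EFin_fin.
rewrite /= EY integralZr// integral_distribution//.
by rewrite integrable_EFin_fin.
Qed.

End independent_product.

Section independence.
Context {d : measure_display} {T : measurableType d} {R : realType}.
Variable P : probability T R.
Implicit Types (G H : set (set T)) (X Y : T -> R).

Lemma sigma_var_measurable X : measurable_fun setT X ->
  sigma_var X `<=` measurable.
Proof. by move=> mX _ [B mB <-]; exact: mX. Qed.

Lemma sigma_var_setI X : setI_closed (sigma_var X).
Proof.
move=> _ _ [B mB <-] [C mC <-]; exists (B `&` C); first exact: measurableI.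
by rewrite !setTI preimage_setI.
Qed.

Lemma g_sigma_algebra_setI G : setI_closed <<s G >>.
Proof. exact: (@measurableI _ (g_sigma_algebraType G)). Qed.

Lemma sigma_varP G X :
  sigma_var X `<=` <<s G >> <->
  measurable_fun (setT : set (g_sigma_algebraType G)) X.
Proof.
split=> [h _ B mB|h _ [B mB <-]]; first by apply: h; exists B.
exact: h.
Qed.

Lemma independent_systemsS G G' H H' : G' `<=` G -> H' `<=` H ->
  independent_systems P G H -> independent_systems P G' H'.
Proof. by move=> GG HH GH A B /GG GA /HH HB; exact: GH. Qed.

Lemma independent_systems_sym G H :
  independent_systems P G H -> independent_systems P H G.
Proof. by move=> GH A B HA GB; rewrite setIC GH// muleC. Qed.

Lemma sigma_var_comp (f : R -> R) X : measurable_fun setT f ->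
  sigma_var (f \o X) `<=` sigma_var X.
Proof.
move=> mf _ [B mB <-]; exists (f @^-1` B) => //.
by rewrite -[X in measurable X]setTI; exact: mf.
Qed.

(** Dynkin's pi-lambda theorem: for fixed C in H, the measurable sets A with P (A and C) = P A * P C
    form a Dynkin system that contains the pi-system G. *)
Lemma independent_g_sigma_algebra G H : setI_closed G ->
  G `<=` measurable -> H `<=` measurable ->
  independent_systems P G H -> independent_systems P <<s G >> H.
Proof.
move=> GI Gm Hm GH A C GA HC; have mC := Hm _ HC.
pose D := [set A | measurable A /\ P (A `&` C) = (P A * P C)%E].
suff : <<s G >> `<=` D by move=> /(_ _ GA) [].
rewrite -setI_closed_g_dynkin_g_sigma_algebra//.
apply: smallest_sub; last first.
  by move=> B GB; split; [exact: Gm|exact: GH].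
have fP B : measurable B -> P B \is a fin_num by exact: fin_num_measure.
split.
- by split => //; rewrite setTI probability_setT mul1e.
- move=> B [mB hB]; split; first exact: measurableC.
  rewrite setIC -setDE measureD// 1?setIC; last first.
    by rewrite ltey_eq fP.
  rewrite probability_setC// muleBl ?mul1e ?fP//.
  by congr (_ - _)%E; exact: hB.
- move=> F tF hF; split; first by apply: bigcup_measurable => k _; case: (hF k).
  have mF k : measurable (F k) by case: (hF k).
  rewrite setI_bigcupl measure_bigcup//; last 2 first.
  + by move=> k _; exact: measurableI.
  + exact: trivIset_setIr.
  rewrite measure_bigcup// -(fineK (fP _ mC)) muleC -nneseriesZl//.
  apply: eq_eseriesr => k _.
  by have [_ h] := hF k; rewrite fineK ?fP// muleC; exact: h.
Qed.

End independence.

(** * Increments of B are independent of the insider's information *)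

Section insider_independence.
Context {d : measure_display} {T : measurableType d} {R : realType}.
Variable P : probability T R.
Variables (V : {RV P >-> R}) (B : R -> {RV P >-> R}).
Hypothesis hB : brownian_motion B.
Hypothesis hVB : independent_systems P (sigma_var V) (sigma_process `[0, 1] B).

Lemma sigma_var_process (D : set R) t : D t ->
  sigma_var (B t) `<=` sigma_process D B.
Proof. by move=> Dt A hA; apply: sub_sigma_algebra; exists t. Qed.

Lemma sigma_process_increment (s t : R) : 0 <= s <= 1 -> 0 <= t <= 1 ->
  sigma_var (fun w => B t w - B s w) `<=` sigma_process `[0, 1] B.
Proof.
move=> hs ht; apply/sigma_varP.
by apply: measurable_funB; apply/sigma_varP; apply: sigma_var_process;
  rewrite /= in_itv.
Qed.

Lemma sigma_process_measurable (D : set R) :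
  sigma_process D B `<=` measurable.
Proof.
apply: smallest_sub; first exact: sigma_algebra_measurable.
by move=> A [t _]; exact: sigma_var_measurable.
Qed.

Lemma sigma_processS (D E : set R) : D `<=` E ->
  sigma_process D B `<=` sigma_process E B.
Proof.
move=> DE; apply: sub_smallest2r; first exact: smallest_sigma_algebra.
by move=> A [t Dt hA]; exists t => //; exact: DE.
Qed.

(** The filtration is generated by the pi-system of intersections of an event A of V with an event C
    of the past of B. For an event D of the increment, C and D together belong to B, so P (A C D) =
    P A * P (C D) = P A * P C * P D = P (A C) * P D. *)
Lemma independent_increment (s t : R) : 0 <= s -> s < t -> t <= 1 ->
  independent_systems P (insider_filtration V B s)
    (sigma_var (fun w => B t w - B s w)).
Proof.
move=> s0 st t1; set H := sigma_var (fun w => _).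
have s01 : 0 <= s <= 1 by rewrite s0/=; lra.
have t01 : 0 <= t <= 1 by rewrite t1 andbT; lra.
have mH : H `<=` measurable.
  by apply: sigma_var_measurable; exact: measurable_funB.
have HS : H `<=` sigma_process `[0, 1] B by exact: sigma_process_increment.
have iH := let: And4 _ h _ _ := hB in h _ _ s0 st t1.
have S01 : sigma_process `[0, s] B `<=` sigma_process `[0, 1] B.
  apply: sigma_processS => x /=; rewrite !in_itv/= => /andP[-> xs] /=.
  by lra.
pose G := [set A `&` C | A in sigma_var V & C in sigma_process `[0, s] B].
have : independent_systems P <<s G >> H.
  apply: independent_g_sigma_algebra => //.
  - move=> _ _ [A hA [C hC <-]] [A' hA' [C' hC' <-]].
    exists (A `&` A'); first exact: sigma_var_setI.
    exists (C `&` C'); first exact: g_sigma_algebra_setI.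
    by rewrite setIACA.
  - move=> _ [A hA [C hC <-]]; apply: measurableI.
    + exact: (sigma_var_measurable _ hA).
    + exact: (sigma_process_measurable hC).
  - move=> _ D [A hA [C hC <-]] hD.
    rewrite -setIA hVB//; last first.
      by apply: g_sigma_algebra_setI; [exact: S01|exact: HS].
    rewrite (hVB hA (S01 _ hC)).
    by rewrite (iH _ _ hC hD) muleA.
apply: independent_systemsS => //.
have sub C D : C `<=` <<s G >> -> D `<=` <<s G >> ->
  <<s C `|` D >> `<=` <<s G >>.
  move=> CG DG; apply: smallest_sub; first exact: smallest_sigma_algebra.
  by move=> A [/CG|/DG].
apply: sub => [A hA|A [r hr hA]]; apply: sub_sigma_algebra.
- exists A => //; exists setT; last by rewrite setIT.
  exact: (@measurableT _ (g_sigma_algebraType _)).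
- exists setT; first by exists setT => //; rewrite setTI preimage_setT.
  exists A; last by rewrite setTI.
  by apply: sub_sigma_algebra; exists r.
Qed.

Lemma sub_insider_filtration (s t : R) : 0 <= s <= t ->
  sigma_var (B s) `<=` insider_filtration V B t.
Proof.
move=> st A hA; apply: sub_sigma_algebra; right; exists s => //=.
Qed.

End insider_independence.

(** * Moments of normal variables and Brownian covariances *)

Section density.
Context {d : measure_display} {T : measurableType d} {R : realType}.
Variables (nu mu : {measure set T -> \bar R}) (g : T -> R).
Hypotheses (mg : measurable_fun setT g) (g0 : forall x, 0 <= g x).
Hypothesis nuE : forall A, measurable A ->
  nu A = (\int[mu]_(x in A) (g x)%:E)%E.
Local Open Scope ereal_scope.
Import HBNNSimple.

Let integral_density_nnsfun (h : {nnsfun T >-> R}) :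
  \int[nu]_x (h x)%:E = \int[mu]_x ((h x)%:E * (g x)%:E).
Proof.
under [LHS]eq_integral do rewrite fimfunE -fsumEFin//.
rewrite [LHS]ge0_integral_fsum//; last 2 first.
  - by move=> r; exact/measurable_EFinP/measurableT_comp.
  - by move=> n x _; rewrite EFinM nnfun_muleindic_ge0.
under [RHS]eq_integral.
  move=> x _; rewrite fimfunE -fsumEFin// muleC ge0_mule_fsumr; last first.
    by move=> r; rewrite EFinM nnfun_muleindic_ge0.
  over.
rewrite [RHS]ge0_integral_fsum//; last 2 first.
  - move=> r; apply: emeasurable_funM; first exact/measurable_EFinP.
    by apply/measurable_EFinP/measurableT_comp.
  - move=> n x _; apply: mule_ge0; first by rewrite lee_fin.
    exact: nnfun_muleindic_ge0.
apply: eq_fsbigr => r _.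
rewrite integralZl_indic_nnsfun//= integral_indic//= setIT nuE//.
have [r0|r0] := ltP r 0%R.
  rewrite preimage_nnfun0// integral_set0 mule0 integral0_eq// => x _.
  by rewrite indic0 mulr0 mule0.
rewrite [RHS](eq_integral (fun x => r%:E * ((g x)%:E * (\1_(h @^-1` [set r]) x)%:E)));
  last by move=> x _; rewrite EFinM muleCA.
rewrite ge0_integralZl//=.
- congr (_ * _); rewrite [LHS]integral_mkcond; apply: eq_integral => x _.
  by rewrite patchE indicE; case: ifPn => _; rewrite ?mule1 ?mule0.
- apply: emeasurable_funM; first exact/measurable_EFinP.
  by apply/measurable_EFinP.
- by move=> x _; rewrite mule_ge0 ?lee_fin.
Qed.

(** Monotone convergence along simple functions on both sides; [g0] keeps the right-hand integrands
    monotone. *)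
Lemma ge0_integral_density (f : T -> \bar R) : measurable_fun setT f ->
  (forall x, 0 <= f x) -> \int[nu]_x f x = \int[mu]_x (f x * (g x)%:E).
Proof.
move=> mf f0; pose f_ := nnsfun_approx measurableT mf.
have fE x : f x = lim ((f_ n x)%:E @[n --> \oo]).
  by apply/esym/cvg_lim => //; exact: cvg_nnsfun_approx.
transitivity (lim (\int[nu]_x (f_ n x)%:E @[n --> \oo])).
  rewrite -monotone_convergence//=.
  - by apply: eq_integral => x _; rewrite fE.
  - by move=> n; exact/measurable_EFinP.
  - by move=> n ? _; rewrite lee_fin.
  - by move=> ? _ ? ? mn; rewrite lee_fin; exact/lefP/nd_nnsfun_approx.
transitivity (lim (\int[mu]_x ((f_ n x)%:E * (g x)%:E) @[n --> \oo])).
  by apply: congr_lim; apply/funext => n; exact: integral_density_nnsfun.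
rewrite -monotone_convergence//=.
- apply: eq_integral => x _; rewrite fE muleC -limeMl//.
    by congr (lim _); apply/funext => A /=; under eq_fun do rewrite muleC.
  by apply: ereal_nondecreasing_is_cvgn => a b ab; rewrite lee_fin;
    exact/lefP/nd_nnsfun_approx.
- by move=> n; apply: emeasurable_funM; exact/measurable_EFinP.
- by move=> n x _; rewrite mule_ge0// lee_fin.
- move=> x _ a b ab; rewrite lee_wpmul2r ?lee_fin//.
  exact/lefP/nd_nnsfun_approx.
Qed.

Lemma integral_density (f : T -> \bar R) : measurable_fun setT f ->
  \int[nu]_x f x = \int[mu]_x (f x * (g x)%:E).
Proof.
move=> mf; rewrite integralE [RHS]integralE.
have max_mulr (a : \bar R) x : maxe (a * (g x)%:E) 0 = maxe a 0 * (g x)%:E.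
  have [a0|a0] := leP a 0.
    by rewrite mul0e; apply/max_idPr; rewrite mule_le0_ge0// lee_fin.
  by apply/max_idPl; rewrite mule_ge0 ?lee_fin// ltW.
rewrite !ge0_integral_density//; last 2 first.
- exact: measurable_funeneg.
- exact: measurable_funepos.
congr (_ - _); apply: eq_integral => x _.
  by rewrite !funeposE max_mulr.
by rewrite !funenegE -max_mulr mulNe.
Qed.

Lemma integrable_density (f : T -> \bar R) : nu.-integrable setT f ->
  mu.-integrable setT (fun x => f x * (g x)%:E).
Proof.
move=> /integrableP[mf intf]; apply/integrableP; split.
  by apply: emeasurable_funM => //; exact/measurable_EFinP.
under eq_integral do rewrite abseM (@gee0_abs _ (_%:E)) ?lee_fin//.
by rewrite -ge0_integral_density//; exact: measurableT_comp.
Qed.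

End density.

(** * Moments of normal laws by comparison of densities *)

Section normal_moments.
Context {R : realType}.
Implicit Types m s x c : R.
Local Notation mu := (@lebesgue_measure R).

Lemma normal_peak_ratio s t : 0 < s -> 0 < t ->
  normal_peak s = t / s * normal_peak t.
Proof.
move=> s0 t0; rewrite /normal_peak -!mulrnAr !(sqrtrM (pi *+ 2)) ?sqr_ge0//.
rewrite !sqrtr_sqr !gtr0_norm//.
have : 0 < Num.sqrt (pi *+ 2 : R) by rewrite sqrtr_gt0 mulrn_wgt0// pi_gt0.
by move=> p0; field; rewrite !gt_eqF.
Qed.

Lemma integral_normal_prob m s (f : R -> \bar R) : measurable_fun setT f ->
  (\int[normal_prob m s]_x f x = \int[mu]_x (f x * (normal_pdf m s x)%:E))%E.
Proof.
move=> mf; apply: integral_density => //.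
- exact: measurable_normal_pdf.
- by move=> x; exact: normal_pdf_ge0.
Qed.

(* Comparing a normal density with another one bounds its moments without
   integrating by parts. *)
Lemma ge0_integral_normal_le m s n t c (h : R -> R) :
  measurable_fun setT h -> (forall x, 0 <= h x) ->
  (forall x, h x * normal_pdf m s x <= c * normal_pdf n t x) ->
  (\int[normal_prob m s]_x (h x)%:E <= c%:E)%E.
Proof.
move=> mh h0 hc; rewrite integral_normal_prob; last exact/measurable_EFinP.
have -> : c%:E = (\int[mu]_x (c%:E * (normal_pdf n t x)%:E))%E.
  by rewrite integralZl// ?integral_normal_pdf ?mule1//; exact: integrable_normal_pdf.
apply: ge0_le_integral => //=.
- by move=> x _; rewrite mule_ge0// lee_fin ?h0 ?normal_pdf_ge0.
- by apply: emeasurable_funM; apply/measurable_EFinP => //; exact: measurable_normal_pdf.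
- by apply: emeasurable_funM; apply/measurable_EFinP => //; exact: measurable_normal_pdf.
- by move=> x _; rewrite -!EFinM lee_fin.
Qed.

(** Signed counterpart, for the functions h of the form 1 + u with 1 + u <= exp u, where exp u is up
    to a constant the ratio of two normal densities. *)
Lemma Rintegral_normal_le m s n t c (h : R -> R) :
  (normal_prob m s).-integrable setT (EFin \o h) ->
  (forall x, h x * normal_pdf m s x <= c * normal_pdf n t x) ->
  \int[normal_prob m s]_x h x <= c.
Proof.
move=> ih hc; rewrite -lee_fin -integrable_EFin_fin//.
rewrite integral_normal_prob; last by case/integrableP: ih.
have ipdf : mu.-integrable setT (fun x => (c%:E * (normal_pdf n t x)%:E)%E).
  by apply: integrableZl => //; exact: integrable_normal_pdf.
have <- : (\int[mu]_x (c%:E * (normal_pdf n t x)%:E))%E = c%:E.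
  by rewrite integralZl// ?integral_normal_pdf ?mule1//; exact: integrable_normal_pdf.
apply: le_integral => //.
- apply: (@integrable_density _ _ _ (normal_prob m s)) => //.
  + exact: measurable_normal_pdf.
  + by move=> x; exact: normal_pdf_ge0.
- by move=> x _; rewrite -!EFinM lee_fin.
Qed.

Section centered.
Variables (m s : R).
Hypothesis s0 : 0 < s.
Local Notation N := (normal_prob m s).

Let pdfE t x : 0 < t -> normal_pdf m t x =
  s / t * normal_peak s * expR (- (x - m) ^+ 2 / (t ^+ 2 *+ 2)).
Proof.
by move=> t0; rewrite normal_pdfE ?gt_eqF//= -normal_peak_ratio.
Qed.

(** Comparison with the density of standard deviation [2 * s]. There y^2 = 64/9 s^4 z^2 <= 128/9 s^4
    exp z, and the ratio of the peaks contributes a factor 2: the constant obtained is 256/9,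
    rounded up to 29. Only the order [s ^+ 4] matters for the quadratic variation of B. *)
Lemma normal_moment4_le :
  (\int[N]_x ((x - m) ^+ 4)%:E <= (29 * s ^+ 4)%:E)%E.
Proof.
apply: (@ge0_integral_normal_le m s m (2 * s)).
- by apply: measurable_funX; exact: measurable_funB.
- by move=> x; rewrite exprn_even_ge0.
move=> x; rewrite !pdfE ?mulr_gt0// divff ?gt_eqF// mul1r.
set y := (x - m) ^+ 2; set p := normal_peak s.
have p0 : 0 < p by rewrite normal_peak_gt0// gt_eqF.
have y0 : 0 <= y by rewrite sqr_ge0.
have -> : (x - m) ^+ 4 = y ^+ 2 by rewrite /y -exprM.
(* [z ^ 2 / 2 <= exp z] for the difference [z] of the two exponents *)
pose z := 3 * y / (8 * s ^+ 2).
have z0 : 0 <= z by rewrite divr_ge0// mulr_ge0// sqr_ge0.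
have hz : 1 + z ^+ 2 / 2 <= expR z.
  by have := expR_ge1Dxn 1 z0.
have -> : - y / ((2 * s) ^+ 2 *+ 2) = - y / (s ^+ 2 *+ 2) + z.
  by rewrite /z; field; rewrite gt_eqF.
rewrite expRD; set e := expR (- y / _).
have e0 : 0 < e by exact: expR_gt0.
have -> : 29 * s ^+ 4 * (s / (2 * s) * p * (e * expR z)) =
  (29 / 2 * s ^+ 4 * expR z) * (p * e) by field; rewrite gt_eqF.
rewrite ler_wpM2r//; first by rewrite ltW// mulr_gt0.
have -> : y ^+ 2 = 64 / 9 * s ^+ 4 * z ^+ 2.
  by rewrite /z; field; rewrite gt_eqF.
have s40 : 0 < s ^+ 4 by rewrite exprn_gt0.
have : s ^+ 4 * (1 + z ^+ 2 / 2) <= s ^+ 4 * expR z by rewrite ler_pM2l.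
have := sqr_ge0 z.
nra.
Qed.

Let mB : measurable_fun setT (fun x => x - m).
Proof. exact: measurable_funB. Qed.

Lemma normal_integrable4 : N.-integrable setT (EFin \o (fun x => (x - m) ^+ 4)).
Proof.
apply/integrableP; split.
  by apply/measurable_EFinP; exact: measurable_funX.
under eq_integral.
  move=> x _; rewrite /= ger0_norm; last by rewrite exprn_even_ge0.
  over.
exact: le_lt_trans normal_moment4_le (ltry _).
Qed.

Lemma normal_sq_integrable : sq_integrable N (fun x => x - m).
Proof.
split => //; apply: (@integrable_EFin_le _ _ _ N setT _ (fun x => (x - m) ^+ 2)
  (fun x => 1 + (x - m) ^+ 4)).
- exact: measurableT.
- exact: (measurable_funX 2 mB).
- apply: integrable_EFinD => //; last exact: normal_integrable4.
  exact: (finite_measure_integrable_cst N 1).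
- move=> x; rewrite ger0_norm ?sqr_ge0//.
  by have := sqr_ge0 ((x - m) ^+ 2 - 1); have := sqr_ge0 (x - m); nra.
Qed.

Let iB := sq_integrable_integrable normal_sq_integrable.
Let iB2 : N.-integrable setT (EFin \o (fun x => (x - m) ^+ 2)) :=
  proj2 normal_sq_integrable.

Let Rintegral_affine (a b : R) (f : R -> R) :
  N.-integrable setT (EFin \o f) ->
  N.-integrable setT (EFin \o (fun x => a + b * f x)) /\
  \int[N]_x (a + b * f x) = a + b * \int[N]_x f x.
Proof.
move=> fi; have ia : N.-integrable setT (EFin \o (fun=> a)).
  exact: (finite_measure_integrable_cst N a).
have ib := integrable_EFinZ measurableT b fi.
split; first exact: integrable_EFinD.
by rewrite RintegralD// Rintegral_probability_cst RintegralZl.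
Qed.

(** The density shifted by e is the original one times exp (e (x - m) / s^2 - e^2 / (2 s^2)), at
    least 1 plus the exponent. Integrating gives 2 e M <= e^2 for every e, of either sign. *)
Lemma normal_mean : \int[N]_x (x - m) = 0.
Proof.
set M := Rintegral _ _ _.
have h (e : R) : 2 * e * M <= e ^+ 2.
  have [i1 E1] := @Rintegral_affine (1 - e ^+ 2 / (2 * s ^+ 2)) (e / s ^+ 2) _ iB.
  have : 1 - e ^+ 2 / (2 * s ^+ 2) + e / s ^+ 2 * M <= 1.
    rewrite -E1; apply: (@Rintegral_normal_le m s (m + e) s) => // x.
    rewrite mul1r !normal_pdfE ?gt_eqF//=.
    rewrite mulrCA; apply: ler_wpM2l; first exact: normal_peak_ge0.
    rewrite /normal_fun.
    have -> : - (x - (m + e)) ^+ 2 / (s ^+ 2 *+ 2) = - (x - m) ^+ 2 / (s ^+ 2 *+ 2)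
       + (- e ^+ 2 / (2 * s ^+ 2) + e / s ^+ 2 * (x - m)).
      by field; rewrite gt_eqF.
    rewrite expRD mulrC ler_wpM2l ?expR_ge0// (le_trans _ (expR_ge1Dx _))//.
    by rewrite mulNr addrA.
  have s20 : 0 < s ^+ 2 by rewrite exprn_gt0.
  have -> : 1 - e ^+ 2 / (2 * s ^+ 2) + e / s ^+ 2 * M =
    1 + (2 * e * M - e ^+ 2) / (2 * s ^+ 2) by field; rewrite gt_eqF.
  rewrite gerDl pmulr_lle0 ?subr_le0// invr_gt0; lra.
(* The choice e = M yields 2 M^2 <= M^2. *)
have := h M; have := sqr_ge0 M => h1 h2.
by apply/eqP; rewrite -sqrf_eq0; apply/eqP; nra.
Qed.

(** Comparing with every other standard deviation t gives 1 + (1 / s^2 - 1 / t^2) M / 2 <= t / s.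
    This is an equality at t = s, and values of t on both sides of s force M = s^2. *)
Lemma normal_variance : \int[N]_x ((x - m) ^+ 2) = s ^+ 2.
Proof.
set M := Rintegral _ _ _.
have M0 : 0 <= M by apply: Rintegral_ge0 => x _; exact: sqr_ge0.
have h (t : R) : 0 < t -> (t - s) * ((t + s) * M - 2 * s * t ^+ 2) <= 0.
  move=> t0.
  have [i1 E1] := @Rintegral_affine 1 ((s ^- 2 - t ^- 2) / 2) _ iB2.
  have : 1 + (s ^- 2 - t ^- 2) / 2 * M <= t / s.
    rewrite -E1; apply: (@Rintegral_normal_le m s m t) => // x.
    rewrite !pdfE// divff ?gt_eqF// mul1r.
    have -> : - (x - m) ^+ 2 / (t ^+ 2 *+ 2) = - (x - m) ^+ 2 / (s ^+ 2 *+ 2)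
       + ((s ^- 2 - t ^- 2) / 2) * (x - m) ^+ 2.
      by field; rewrite !gt_eqF.
    rewrite expRD; set e := expR (- _ / _); set f := expR _.
    have -> : t / s * (s / t * normal_peak s * (e * f)) = f * (normal_peak s * e).
      by field; rewrite !gt_eqF.
    rewrite ler_wpM2r ?mulr_ge0 ?expR_ge0 ?normal_peak_ge0//.
    exact: expR_ge1Dx.
  rewrite -subr_le0.
  have -> : 1 + (s ^- 2 - t ^- 2) / 2 * M - t / s =
    (t - s) * ((t + s) * M - 2 * s * t ^+ 2) / (2 * s ^+ 2 * t ^+ 2).
    by field; rewrite !gt_eqF.
  by rewrite pmulr_lle0// invr_gt0 !mulr_gt0// exprn_gt0.
have s20 : 0 < s ^+ 2 by rewrite exprn_gt0.
(* The square of t is the midpoint of s^2 and M. If t differed from s, then t^2 would lie strictly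
   between s^2 and M, against [h]. *)
have [t t0 t2] : exists2 t, 0 < t & t ^+ 2 = (s ^+ 2 + M) / 2.
  exists (Num.sqrt ((s ^+ 2 + M) / 2)); first by rewrite sqrtr_gt0; lra.
  by rewrite sqr_sqrtr; lra.
have := h t t0.
have [ts|st|ts _] := ltgtP t s.
- have : t ^+ 2 < s ^+ 2 by rewrite ltr_pXn2r// nnegrE ltW.
  rewrite nmulr_rle0 ?subr_lt0// => h1 h2.
  have : 0 < (t + s) * (t ^+ 2 - M) by rewrite mulr_gt0 ?(addr_gt0 t0 s0)// subr_gt0; lra.
  have : 0 < (s - t) * t ^+ 2 by rewrite mulr_gt0 ?subr_gt0 ?exprn_gt0.
  lra.
- have : s ^+ 2 < t ^+ 2 by rewrite ltr_pXn2r// nnegrE ltW.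
  rewrite pmulr_rle0 ?subr_gt0// => h1 h2.
  have : 0 < (t + s) * (M - t ^+ 2) by rewrite mulr_gt0 ?(addr_gt0 t0 s0)// subr_gt0; lra.
  have : 0 < (t - s) * t ^+ 2 by rewrite mulr_gt0 ?subr_gt0 ?exprn_gt0.
  lra.
- by rewrite ts in t2; lra.
Qed.

End centered.
End normal_moments.

Section normal_variable.
Context {d : measure_display} {T : measurableType d} {R : realType}.
Variables (P : probability T R) (X : T -> R) (m s : R).
Hypotheses (mX : measurable_fun setT X) (nX : is_normal P X m s).
Local Notation N := (normal_prob m s).

Let rX : {RV P >-> measurableTypeR R} :=
  HB.pack X (isMeasurableFun.Build _ _ T (measurableTypeR R) X mX).

Let NE (f : measurableTypeR R -> \bar R) :
  (\int[N]_x f x = \int[distribution P rX]_x f x)%E.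
Proof. by apply: eq_measure_integral => A mA _; apply: esym; exact: nX. Qed.

Lemma ge0_integral_is_normal (f : R -> \bar R) : measurable_fun setT f ->
  (forall x, 0 <= f x)%E -> (\int[P]_w f (X w) = \int[N]_x f x)%E.
Proof.
by move=> mf f0; rewrite NE ge0_integral_distribution.
Qed.

Variable f : R -> R.
Hypothesis fi : N.-integrable setT (EFin \o f).

Let mf : measurable_fun setT f.
Proof. by apply/measurable_EFinP; case/integrableP: fi. Qed.

Lemma is_normal_integrable : P.-integrable setT (EFin \o (fun w => f (X w))).
Proof.
apply/integrableP; split.
  by apply/measurable_EFinP; exact: measurableT_comp.
move: fi => /integrableP[_].
rewrite -ge0_integral_is_normal//.
by apply: measurableT_comp => //; exact/measurable_EFinP.
Qed.

Lemma is_normal_Rintegral : \int[P]_w f (X w) = \int[N]_x f x.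
Proof.
congr fine; rewrite NE integral_distribution//; first exact/measurable_EFinP.
exact: is_normal_integrable.
Qed.

End normal_variable.

(** * Moments and covariances of Brownian motion *)

Section brownian.
Context {d : measure_display} {T : measurableType d} {R : realType}.
Variable P : probability T R.
Variables (V : {RV P >-> R}) (B : R -> {RV P >-> R}).
Hypothesis hB : brownian_motion B.
Hypothesis hVB : independent_systems P (sigma_var V) (sigma_process `[0, 1] B).
Implicit Types s t : R.

Let mD s t : measurable_fun setT (fun w => B t w - B s w).
Proof. exact: measurable_funB. Qed.

Lemma brownian_eq0 : {ae P, forall w, B 0 w = 0}.
Proof. by case: hB. Qed.

Section increment.
Variables s t : R.
Hypotheses (s0 : 0 <= s) (st : s <= t) (t1 : t <= 1).

(** Brownian motion is specified for [s < t] only. The degenerate case is treated apart because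
    subdivisions of elementary processes may repeat points. *)
Let increment_cst : s = t -> (fun w => B t w - B s w) = cst 0.
Proof. by move=> ->; apply/funext => w; rewrite subrr. Qed.

Let nD : s < t -> is_normal P (fun w => B t w - B s w) 0 (Num.sqrt (t - s)).
Proof. by case: hB => _ _ + _; move=> + ?; apply. Qed.

Let sqrt_gt0 : s < t -> 0 < Num.sqrt (t - s).
Proof. by rewrite sqrtr_gt0 subr_gt0. Qed.

Lemma sq_integrable_increment : sq_integrable P (fun w => B t w - B s w).
Proof.
have [e|ts] := eqVneq s t.
  by rewrite (increment_cst e); exact: sq_integrable_cst.
have lst : s < t by rewrite lt_neqAle ts.
split => //.
have := is_normal_integrable (mD s t) (nD lst)
  (normal_sq_integrable 0 (sqrt_gt0 lst)).2.
by under eq_fun do rewrite subr0.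
Qed.

Lemma Rintegral_increment : \int[P]_w (B t w - B s w) = 0.
Proof.
have [e|ts] := eqVneq s t.
  by rewrite (increment_cst e) Rintegral_probability_cst.
have lst : s < t by rewrite lt_neqAle ts.
have iN := sq_integrable_integrable (normal_sq_integrable 0 (sqrt_gt0 lst)).
have := is_normal_Rintegral (mD s t) (nD lst) iN.
rewrite normal_mean ?sqrt_gt0// => h.
by rewrite -[RHS]h; apply: eq_Rintegral => w _; rewrite subr0.
Qed.

Lemma Rintegral_increment2 : \int[P]_w ((B t w - B s w) ^+ 2) = t - s.
Proof.
have [e|ts] := eqVneq s t.
  rewrite e subrr.
  under eq_Rintegral do rewrite subrr expr0n/=.
  by rewrite Rintegral_probability_cst.
have lst : s < t by rewrite lt_neqAle ts.
have iN := (normal_sq_integrable 0 (sqrt_gt0 lst)).2.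
have := is_normal_Rintegral (mD s t) (nD lst) iN.
rewrite normal_variance ?sqrt_gt0// sqr_sqrtr ?subr_ge0 ?ltW// => h.
by rewrite -[RHS]h; apply: eq_Rintegral => w _; rewrite subr0.
Qed.

Lemma increment4 : P.-integrable setT (EFin \o (fun w => (B t w - B s w) ^+ 4)) /\
  \int[P]_w ((B t w - B s w) ^+ 4) <= 29 * (t - s) ^+ 2.
Proof.
have [e|ts] := eqVneq s t.
  have -> : (fun w => (B t w - B s w) ^+ 4) = cst 0.
    by apply/funext => w; rewrite e subrr expr0n.
  rewrite Rintegral_probability_cst mulr_ge0// ?sqr_ge0//; split => //.
  exact: (finite_measure_integrable_cst P 0).
have lst : s < t by rewrite lt_neqAle ts.
have iN := normal_integrable4 0 (sqrt_gt0 lst).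
have i4 := is_normal_integrable (mD s t) (nD lst) iN.
have E4 := is_normal_Rintegral (mD s t) (nD lst) iN.
have sub0 : (fun w => (B t w - B s w - 0) ^+ 4) = (fun w => (B t w - B s w) ^+ 4).
  by apply/funext => w; rewrite subr0.
rewrite sub0 in i4 E4.
split => //; rewrite E4 -lee_fin -integrable_EFin_fin//.
apply: (le_trans (normal_moment4_le 0 (sqrt_gt0 lst))).
by rewrite (exprM _ 2 2) sqr_sqrtr ?subr_ge0.
Qed.

Variable e : T -> R.
Hypothesis me : measurable_fun setT e.
Hypothesis ei : P.-integrable setT (EFin \o e).
Hypothesis eF : sigma_var e `<=` insider_filtration V B s.

(** Two choices of f are used: the identity, for the mean of elementary integrals, and x^2 - 1/n,
    for the orthogonality of the errors in the quadratic variation. *)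
Lemma Rintegral_adapted_increment (f : R -> R) : measurable_fun setT f ->
  P.-integrable setT (EFin \o (fun w => f (B t w - B s w))) ->
  s < t ->
  \int[P]_w (e w * f (B t w - B s w)) =
  \int[P]_w e w * \int[P]_w f (B t w - B s w).
Proof.
move=> mf fi st'; apply: independent_RintegralM => //.
  exact: measurableT_comp.
apply: independent_systemsS (independent_increment hB hVB s0 st' t1) => //.
exact: sigma_var_comp.
Qed.

Lemma Rintegral_adapted_increment0 : \int[P]_w (e w * (B t w - B s w)) = 0.
Proof.
have [est|ts] := eqVneq s t.
  under eq_Rintegral do rewrite est subrr mulr0.
  by rewrite Rintegral_probability_cst.
have st' : s < t by rewrite lt_neqAle ts.
have iD := sq_integrable_integrable sq_integrable_increment.
rewrite (@Rintegral_adapted_increment id)//.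
by rewrite Rintegral_increment mulr0.
Qed.

End increment.

Lemma sub_brownian0 t : {ae P, forall w, B t w - B 0 w = B t w}.
Proof. by apply: filterS brownian_eq0 => w ->; rewrite subr0. Qed.

Lemma sq_integrable_brownian t : 0 <= t <= 1 -> sq_integrable P (B t).
Proof.
move=> /andP[t0 t1].
have := sq_integrable_increment (lexx 0) t0 t1.
by apply: sq_integrable_ae => //; exact: sub_brownian0.
Qed.

Lemma Rintegral_brownian t : 0 <= t <= 1 -> \int[P]_w B t w = 0.
Proof.
move=> /andP[t0 t1]; rewrite -(Rintegral_increment (lexx 0) t0 t1).
by apply: eq_Rintegral_ae; apply: filterS (sub_brownian0 t) => w ->.
Qed.

Lemma Rintegral_brownian2 t : 0 <= t <= 1 -> \int[P]_w (B t w ^+ 2) = t.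
Proof.
move=> /andP[t0 t1]; rewrite -[RHS]subr0 -(Rintegral_increment2 (lexx 0) t0 t1).
by apply: eq_Rintegral_ae; apply: filterS (sub_brownian0 t) => w ->.
Qed.

Lemma Rintegral_brownianM s t : 0 <= s <= 1 -> 0 <= t <= 1 ->
  \int[P]_w (B s w * B t w) = Num.min s t.
Proof.
wlog st : s t / s <= t.
  move=> h hs ht; have [st|/ltW ts] := leP s t; first by rewrite h// min_l.
  by under eq_Rintegral do rewrite mulrC; rewrite h// min_l.
move=> hs ht; rewrite min_l//.
have sB := sq_integrable_brownian hs; have sBt := sq_integrable_brownian ht.
have [[s0 s1] [t0 t1]] := (andP hs, andP ht).
have sI := sq_integrable_increment s0 st t1.
have -> : (fun w => B s w * B t w) =
    (fun w => B s w ^+ 2 + B s w * (B t w - B s w)).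
  by apply/funext => w; ring.
rewrite RintegralD//; [|by case: sB|exact: sq_integrableM].
rewrite Rintegral_brownian2// Rintegral_adapted_increment0 ?addr0//.
- exact: sq_integrable_integrable.
- by apply: sub_insider_filtration; rewrite s0 lexx.
Qed.

Lemma Rintegral_price_brownian (e : T -> R) t : 0 <= t <= 1 ->
  measurable_fun setT e -> P.-integrable setT (EFin \o e) ->
  sigma_var e `<=` sigma_var V -> \int[P]_w (B t w * e w) = 0.
Proof.
move=> t01 me ei eV.
rewrite independent_RintegralM//.
- by rewrite Rintegral_brownian// mul0r.
- apply/independent_systems_sym/(independent_systemsS _ _ hVB) => //.
  by apply: sigma_var_process; rewrite /= in_itv.
- exact/sq_integrable_integrable/sq_integrable_brownian.
Qed.

End brownian.

(** * Processes with continuous paths *)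

Section clamp.
Context {R : realType}.

(** Composing with this projection turns continuity within [[0, 1]] into continuity on the whole
    line. *)
Definition clamp01 (t : R) : R := Num.max 0 (Num.min t 1).

Lemma clamp01_itv t : 0 <= clamp01 t <= 1.
Proof. by rewrite /clamp01 le_max lexx/= ge_max ler01 ge_min lexx orbT. Qed.

Lemma clamp01_id t : 0 <= t <= 1 -> clamp01 t = t.
Proof. by move=> /andP[t0 t1]; rewrite /clamp01 (min_l t1) (max_r t0). Qed.

Lemma continuous_clamp01 : continuous clamp01.
Proof.
move=> t; apply: (@continuous_max R R (fun=> 0) (fun t => Num.min t 1)).
  exact: cst_continuous.
apply: (@continuous_min R R id (fun=> 1)); first exact: cvg_id.
exact: cst_continuous.
Qed.

Lemma continuous_comp_clamp01 (f : R -> R) :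
  {within `[0, 1], continuous f} -> continuous (f \o clamp01).
Proof.
move=> /subspace_continuousP cf t.
have I01 x : `[0, 1]%classic (clamp01 x) by rewrite /= in_itv/= clamp01_itv.
apply: cvg_comp (cf _ (I01 t)) => U hU.
have : nbhs t (clamp01 @^-1` [set x | `[0, 1]%classic x -> U x]).
  exact: continuous_clamp01 hU.
by apply: (@filterS _ (nbhs t)) => x /(_ (I01 x)).
Qed.

End clamp.

Section deterministic_integrals.
Context {R : realType}.
Local Notation mu := (@lebesgue_measure R).
Implicit Types (f F : R -> R) (a b : R).

Lemma within_continuous_itv f a b :
  (forall x, a <= x <= b -> {for x, continuous f}) ->
  {within `[a, b], continuous f}.
Proof.
move=> cf; apply: continuous_in_subspaceT => x /set_mem/=.
by rewrite in_itv/=; exact: cf.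
Qed.

Lemma integrable_itv f a b :
  (forall x, a <= x <= b -> {for x, continuous f}) ->
  mu.-integrable `[a, b] (EFin \o f).
Proof.
move=> cf; apply: continuous_compact_integrable; first exact: segment_compact.
exact: within_continuous_itv.
Qed.

Lemma Rintegral_is_derive f F a b : a <= b ->
  (forall x, a <= x <= b -> is_derive x 1 F (f x)) ->
  (forall x, a <= x <= b -> {for x, continuous f}) ->
  \int[mu]_(x in `[a, b]) f x = F b - F a.
Proof.
rewrite le_eqVlt => /predU1P[-> _ _|ab dF cf].
  by rewrite set_itv1 Rintegral_set1 subrr.
have cF x : a <= x <= b -> {for x, continuous F}.
  move=> xab; apply/differentiable_continuous; rewrite -derivable1_diffP.
  by have := dF _ xab => -[].
rewrite /Rintegral (@continuous_FTC2 _ f F)//.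
- exact: within_continuous_itv.
- split.
  + move=> x; rewrite in_itv/= => /andP[/ltW ax /ltW xb].
    by have [] : is_derive x 1 F (f x) by apply: dF; rewrite ax.
  + by apply: cvg_at_right_filter; apply: cF; rewrite lexx ltW.
  + by apply: cvg_at_left_filter; apply: cF; rewrite lexx ltW.
- move=> x; rewrite in_itv/= => /andP[/ltW ax /ltW xb].
  have dx : is_derive x 1 F (f x) by apply: dF; rewrite ax.
  by rewrite derive1E derive_val.
Qed.

Lemma Rintegral_itv_split f a c b : a <= c <= b ->
  mu.-integrable `[a, b] (EFin \o f) ->
  \int[mu]_(x in `[a, b]) f x =
  \int[mu]_(x in `[a, c]) f x + \int[mu]_(x in `[c, b]) f x.
Proof.
move=> /andP[ac cb] fi.
have := @Rintegral_itvB _ f (BLeft a) (BRight b) c fi.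
rewrite !bnd_simp => /(_ ac cb).
rewrite Rintegral_itv_obnd_cbnd; last first.
  apply: integrableS fi => //; apply: subset_itv; rewrite bnd_simp//.
by move=> <-; rewrite addrC subrK.
Qed.

Lemma is_derive_Rintegral f a b x : continuous f -> a < x < b ->
  is_derive x 1 (fun t => \int[mu]_(s in `[a, t]) f s) (f x).
Proof.
move=> cf /andP[ax xb].
have [||dF <-] := @continuous_FTC1_closed _ f a x b xb _ ax.
- by apply: integrable_itv => y _; exact: cf.
- exact: cf.
- by rewrite derive1E; exact: DeriveDef.
Qed.

(** With c the integral of f, expanding that of (f - c)^2 gives (2 - (b - a)) c^2 at most the
    integral of f^2, and the length b - a is at most 1. *)
Lemma sqr_Rintegral_itv_le f a b : a <= b <= a + 1 ->
  (forall x, a <= x <= b -> {for x, continuous f}) ->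
  (\int[mu]_(x in `[a, b]) f x) ^+ 2 <= \int[mu]_(x in `[a, b]) (f x ^+ 2).
Proof.
move=> /andP[ab ba1] cf; set c := Rintegral _ _ _.
have i1 : mu.-integrable `[a, b] (EFin \o f) by exact: integrable_itv.
have i2 : mu.-integrable `[a, b] (EFin \o (fun x => f x ^+ 2)).
  apply: integrable_itv => x /cf cx.
  exact: (continuousM cx cx).
have ic : mu.-integrable `[a, b] (EFin \o (fun=> c ^+ 2)).
  by apply: integrable_itv => x _; exact: cst_continuous.
have icf : mu.-integrable `[a, b] (EFin \o (fun x => - 2 * c * f x)).
  exact: integrable_EFinZ.
have : 0 <= \int[mu]_(x in `[a, b]) ((f x - c) ^+ 2).
  by apply: Rintegral_ge0 => x _; exact: sqr_ge0.
have -> : (fun x => (f x - c) ^+ 2) =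
    (fun x => f x ^+ 2 + ((- 2 * c) * f x + c ^+ 2)).
  by apply/funext => x; ring.
rewrite RintegralD//; last exact: integrable_EFinD.
rewrite RintegralD// RintegralZl// Rintegral_cst//=.
rewrite lebesgue_measure_itv/= lte_fin -/c.
have -> : fine (if (a < b)%R then (b%:E - a%:E)%E else 0%E) = b - a.
  by case: ltgtP ab => // -> _; rewrite subrr.
have := sqr_ge0 c; nra.
Qed.

End deterministic_integrals.

(** * Joint measurability and Fubini for continuous processes *)

Section processes_integrals.
Context {d : measure_display} {T : measurableType d} {R : realType}.
Local Notation mu := (@lebesgue_measure R).
Local Notation RT := (measurableTypeR R).

(* A process with continuous paths is the pointwise limit of the processes
   sampled at the times [floor (n * t) / n]. *)
Lemma measurable_continuous_process (X : R -> T -> R) :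
  (forall t, measurable_fun setT (X t)) -> (forall w, continuous (X^~ w)) ->
  measurable_fun setT (fun p : T * RT => X p.2 p.1).
Proof.
move=> mX cX.
pose g (n : nat) (t : R) : R := (Num.floor (t * n.+1%:R))%:~R / n.+1%:R.
have gcvg t : g n t @[n --> \oo] --> t.
  apply/cvgrPdist_le => e e0; near=> n.
  have n0 : 0 < n.+1%:R :> R by [].
  have -> : t - g n t = (t * n.+1%:R - (Num.floor (t * n.+1%:R))%:~R) / n.+1%:R.
    by rewrite /g mulrBl mulfK// gt_eqF.
  have /andP[h1 h2] := floor_itv (t * n.+1%:R).
  rewrite intrD in h2.
  rewrite ger0_norm; last by rewrite divr_ge0// subr_ge0.
  apply: (@le_trans _ _ n.+1%:R^-1).
    by rewrite ler_pdivrMr// mulVf ?gt_eqF//; lra.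
  apply/ltW; near: n; exact: (near_infty_natSinv_lt (PosNum e0)).
apply: (@measurable_fun_cvg _ _ _ _ (fun n p => X (g n p.2) p.1)).
- move=> n _ A mA; rewrite setTI.
  have -> : (fun p : T * RT => X (g n p.2) p.1) @^-1` A =
    \bigcup_(k : int) (X (k%:~R / n.+1%:R) @^-1` A `*`
      [set t : RT | Num.floor (t * n.+1%:R) = k]).
    apply/seteqP; split => [[w t] /= h|[w t] /= [k _ [/= h e]]]; last first.
      by rewrite /g e.
    by exists (Num.floor (t * n.+1%:R)).
  apply: countable_bigcupT_measurable; first exact: countableP.
  move=> k; apply: measurableX.
    by rewrite -[X in measurable X]setTI; exact: mX.
  have -> : [set t : RT | Num.floor (t * n.+1%:R) = k] =
      `[k%:~R / n.+1%:R, (k + 1)%:~R / n.+1%:R[%classic.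
    apply/seteqP; split => [t /= <-|t /=].
      by rewrite in_itv/= ler_pdivrMr// ltr_pdivlMr// floor_itv.
    by rewrite in_itv/= ler_pdivrMr// ltr_pdivlMr// => h; exact: floor_def.
  exact: measurable_itv.
- by move=> [w t] _ /=; apply: (@continuous_cvg _ _ _ _ _ _ (X^~ w)); [exact: cX|exact: gcvg].
Unshelve. all: by end_near. Qed.

Variable P : probability T R.
Variables (X : R -> T -> R) (a b C : R).
Hypothesis mX : measurable_fun setT (fun p : T * RT => X p.2 p.1).
Hypothesis pX : forall w, mu.-integrable `[a, b] (EFin \o (X^~ w)).
Hypothesis iX : forall s, a <= s <= b -> P.-integrable setT (EFin \o X s).
Hypothesis bX : forall s, a <= s <= b -> \int[P]_w `|X s w| <= C.

Let f (p : T * RT) : \bar R := (X p.2 p.1 * \1_`[a, b] p.2)%:E.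

Let mf : measurable_fun setT f.
Proof.
apply/measurable_EFinP; apply: measurable_funM => //.
by apply: measurableT_comp => //; exact: measurable_indic.
Qed.

Let intX w : (\int[mu]_s f (w, s) = (\int[mu]_(s in `[a, b]) X s w)%:E)%E.
Proof.
rewrite -integrable_EFin_fin// [RHS]integral_mkcond.
apply: eq_integral => s _; rewrite patchE /f indicE/=.
by case: ifPn; rewrite ?(mulr1, mulr0).
Qed.

Let intP s : (\int[P]_w f (w, s) =
  ((fun s => (\int[P]_w X s w)%:E) \_ `[a, b]) s)%E.
Proof.
rewrite patchE /f/= indicE; case: ifPn => [/set_mem/=|_].
  rewrite in_itv/= => sab.
  under eq_integral do rewrite mulr1.
  by rewrite -integrable_EFin_fin//; exact: iX.
by under eq_integral do rewrite mulr0; rewrite integral0.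
Qed.

(** Integrating over outcomes before time, the uniform bound [bX] on first absolute moments and the
    bounded time interval make the product integral finite. *)
Let intf : (P \x mu)%E.-integrable setT f.
Proof.
apply/integrable21ltyP => //.
apply: (@le_lt_trans _ _ (\int[mu]_(s in `[a, b]) `|C|%:E)%E).
  rewrite [leRHS]integral_mkcond; apply: ge0_le_integral => //.
  - by move=> s _; exact: integral_ge0.
  - apply: (@measurable_fun_fubini_tonelli_G _ _ _ _ _ P (abse \o f)) => //.
      exact: measurableT_comp.
    by move=> p /=.
  - have mab : measurable (`[a, b] : set RT) by exact: measurable_itv.
    by apply/(measurable_restrictT _ mab); exact: measurable_cst.
  move=> s _; rewrite patchE /f/= indicE; case: ifPn => [/set_mem/=|_].
    rewrite in_itv/= => sab; under eq_integral do rewrite mulr1.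
    rewrite (@integrable_EFin_fin _ _ _ P setT measurableT (fun w => `|X s w|)).
      by rewrite lee_fin (le_trans (bX sab))// ler_norm.
    by have /integrable_norm := iX sab.
  by under eq_integral do rewrite mulr0 normr0; rewrite integral0.
by rewrite integral_cst//= lebesgue_measure_itv/=; case: ifPn => _;
  rewrite ?mule0 ?ltry// -EFinB -EFinM ltry.
Qed.

Lemma integrable_process_integral :
  P.-integrable setT (EFin \o (fun w => \int[mu]_(s in `[a, b]) X s w)).
Proof.
apply: eq_integrable (integrable_fubini_F intf) => // w _.
by rewrite /fubini_F intX.
Qed.

Lemma Rintegral_process_integral :
  \int[P]_w \int[mu]_(s in `[a, b]) X s w =
  \int[mu]_(s in `[a, b]) \int[P]_w X s w.
Proof.
congr fine; transitivity (\int[P]_w \int[mu]_s f (w, s))%E.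
  by apply: eq_integral => w _; rewrite intX.
rewrite Fubini// [RHS]integral_mkcond.
by apply: eq_integral => s _; rewrite intP.
Qed.

End processes_integrals.

(** * The equilibrium *)

Section real_derivatives.
Context {R : realType}.
Implicit Types (f g : R -> R) (x : R).

Lemma is_derive_mulr f g x (df dg : R) :
  is_derive x (1 : R) f df -> is_derive x (1 : R) g dg ->
  is_derive x (1 : R) (fun y => f y * g y) (f x * dg + df * g x).
Proof.
move=> hf hg; apply: (is_derive_eq (is_deriveM hf hg)).
by rewrite [df * _]mulrC.
Qed.

Lemma is_derive_mull (c : R) f x (df : R) : is_derive x (1 : R) f df ->
  is_derive x (1 : R) (fun y => c * f y) (c * df).
Proof. by move=> hf; exact: (is_deriveZ c hf). Qed.

Lemma is_derive_invr f x (df : R) : f x != 0 -> is_derive x (1 : R) f df ->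
  is_derive x (1 : R) (fun y => (f y)^-1) (- df / f x ^+ 2).
Proof.
move=> fx0 hf; apply: (is_derive_eq (is_deriveV fx0 hf)).
by rewrite [LHS]mulNr mulNr mulrC.
Qed.

Lemma is_derive_continuous f x (df : R) :
  is_derive x (1 : R) f df -> {for x, continuous f}.
Proof.
by move=> [dF _]; apply/differentiable_continuous; rewrite -derivable1_diffP.
Qed.

End real_derivatives.

(** * Deterministic kernels and their integrals *)

Section kernels.
Context {R : realType}.
Local Notation mu := (@lebesgue_measure R).
Variable L : R.
Hypotheses (L0 : 0 < L) (L1 : L ^+ 2 < 1).
Implicit Types s t : R.

(** [horizon] will be the variance of Z - L Y_t / sigma, the part of the signal not yet revealed.
    [kernel] is the psi of the overview, [kernel_deriv] its derivative and [kernel_prim] its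
    primitive vanishing at 0. *)
Definition horizon t : R := 1 - t * L ^+ 2.
Definition kernel t : R := L / horizon t.
Definition kernel_deriv t : R := L ^+ 3 / horizon t ^+ 2.
Definition kernel_prim t : R := - ln (horizon t) / L.

(** The strict bound [L ^+ 2 < 1], which amounts to a positive penalty, keeps the denominators
    positive up to and including the terminal time 1. *)
Lemma horizon_gt0 t : 0 <= t <= 1 -> 0 < horizon t.
Proof.
move=> /andP[t0 t1]; rewrite subr_gt0 (le_lt_trans _ L1)//.
by rewrite ler_piMl// sqr_ge0.
Qed.

Lemma horizon_ge t : 0 <= t <= 1 -> 1 - L ^+ 2 <= horizon t.
Proof. by move=> /andP[t0 t1]; rewrite lerB// ler_piMl// sqr_ge0. Qed.

Lemma is_derive_horizon t : is_derive t (1 : R) horizon (- L ^+ 2).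
Proof.
have h := is_derive_mull (L ^+ 2) (is_derive_id t (1 : R)).
have -> : horizon = (fun t => cst 1 t - L ^+ 2 * t).
  by apply/funext => x; rewrite /horizon mulrC.
by apply: (is_derive_eq (is_deriveB (is_derive_cst _ t (1 : R)) h));
  rewrite sub0r mulr1.
Qed.

Lemma is_derive_inv_horizon t : 0 <= t <= 1 ->
  is_derive t (1 : R) (fun t => (horizon t)^-1) (L ^+ 2 / horizon t ^+ 2).
Proof.
move=> /horizon_gt0 h0.
apply: (is_derive_eq (is_derive_invr (lt0r_neq0 h0) (is_derive_horizon t))).
by rewrite opprK.
Qed.

Lemma is_derive_kernel t : 0 <= t <= 1 ->
  is_derive t (1 : R) kernel (kernel_deriv t).
Proof.
move=> /is_derive_inv_horizon/(is_derive_mull L) dZ.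
by apply: (is_derive_eq dZ); rewrite /kernel_deriv mulrA -exprS.
Qed.

Lemma is_derive_kernel_prim t : 0 <= t <= 1 ->
  is_derive t (1 : R) kernel_prim (kernel t).
Proof.
move=> t01; have h0 := horizon_gt0 t01.
have h : is_derive t (1 : R) (fun t => ln (horizon t)) ((horizon t)^-1 * - L ^+ 2).
  exact: (@is_derive1_comp _ _ _ _ _ _ (is_derive1_ln h0) (is_derive_horizon t)).
have -> : kernel_prim = (fun t => - L^-1 * ln (horizon t)).
  by apply/funext => x; rewrite /kernel_prim; ring.
apply: (is_derive_eq (is_derive_mull (- L^-1) h)); rewrite /kernel.
by field; rewrite !gt_eqF.
Qed.

Lemma continuous_kernel_deriv t : 0 <= t <= 1 ->
  {for t, continuous kernel_deriv}.
Proof.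
move=> t01; have h := is_derive_continuous (is_derive_inv_horizon t01).
have -> : kernel_deriv =
    (fun t => L ^+ 3 * ((horizon t)^-1 * (horizon t)^-1)).
  by apply/funext => x; rewrite /kernel_deriv -exprVn expr2.
by apply: continuousM; [exact: cst_continuous|exact: continuousM].
Qed.

Lemma kernel_deriv_ge0 t : 0 <= kernel_deriv t.
Proof. by rewrite divr_ge0// ?sqr_ge0// exprn_ge0// ltW. Qed.

Lemma kernel_deriv_le t : 0 <= t <= 1 -> kernel_deriv t <= kernel_deriv 1.
Proof.
move=> t01; have h0 := horizon_gt0 t01; have h1 := horizon_ge t01.
have L20 : 0 < 1 - L ^+ 2 by rewrite subr_gt0.
have hE : horizon 1 = 1 - L ^+ 2 by rewrite /horizon mul1r.
apply: ler_wpM2l; first by rewrite exprn_ge0// ltW.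
rewrite hE lef_pV2 ?posrE ?exprn_gt0//.
by apply: lerXn2r => //; rewrite nnegrE ltW.
Qed.

Lemma horizon0 : horizon 0 = 1. Proof. by rewrite /horizon mul0r subr0. Qed.

Lemma kernel_prim0 : kernel_prim 0 = 0.
Proof. by rewrite /kernel_prim horizon0 ln1 oppr0 mul0r. Qed.

(** This is the covariance of W_s with int_0^t psi' W, since E[W_s W_r] = min s r. The two halves of
    the integral have the primitives r psi(r) - Psi(r) and s psi(r), where Psi is [kernel_prim]. *)
Lemma Rintegral_kernel_deriv_min s t : 0 <= s -> s <= t -> t <= 1 ->
  \int[mu]_(r in `[0, t]) (kernel_deriv r * Num.min s r) =
  s * kernel t - kernel_prim s.
Proof.
move=> s0 st t1.
have cmin r : {for r, continuous (fun r => Num.min s r)}.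
  by apply: (@continuous_min R R (fun=> s) id); [exact: cst_continuous|exact: cvg_id].
rewrite (@Rintegral_itv_split _ _ _ s); first last.
- apply: integrable_itv => r /andP[r0 rt]; apply: continuousM => //.
  by apply: continuous_kernel_deriv; rewrite r0/=; lra.
- by rewrite s0.
have -> : \int[mu]_(r in `[0, s]) (kernel_deriv r * Num.min s r) =
    \int[mu]_(r in `[0, s]) (kernel_deriv r * r).
  apply: eq_Rintegral => r /set_mem/=; rewrite in_itv/= => /andP[_ rs].
  by rewrite min_r.
have -> : \int[mu]_(r in `[s, t]) (kernel_deriv r * Num.min s r) =
    \int[mu]_(r in `[s, t]) (kernel_deriv r * s).
  apply: eq_Rintegral => r /set_mem/=; rewrite in_itv/= => /andP[sr _].
  by rewrite min_l.
have r01 r : 0 <= r -> r <= t -> 0 <= r <= 1.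
  by move=> -> rt; rewrite (le_trans rt).
have d1 r : 0 <= r <= s -> is_derive r (1 : R)
    (fun r => r * kernel r - kernel_prim r) (kernel_deriv r * r).
  move=> /andP[r0 rs]; have {}r01 := r01 _ r0 (le_trans rs st).
  have dB := is_deriveB
    (is_derive_mulr (is_derive_id r (1 : R)) (is_derive_kernel r01))
    (is_derive_kernel_prim r01).
  by apply: (is_derive_eq dB); rewrite mul1r addrK mulrC.
have d2 r : s <= r <= t -> is_derive r (1 : R)
    (fun r => s * kernel r) (kernel_deriv r * s).
  move=> /andP[sr rt]; have {}r01 := r01 _ (le_trans s0 sr) rt.
  apply: (is_derive_eq (is_derive_mull s (is_derive_kernel r01))).
  by rewrite mulrC.
have c1 r : 0 <= r <= s -> {for r, continuous (fun r => kernel_deriv r * r)}.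
  move=> /andP[r0 rs]; have {}r01 := r01 _ r0 (le_trans rs st).
  apply: continuousM; last exact: cvg_id.
  exact: (continuous_kernel_deriv r01).
have c2 r : s <= r <= t -> {for r, continuous (fun r => kernel_deriv r * s)}.
  move=> /andP[sr rt]; have {}r01 := r01 _ (le_trans s0 sr) rt.
  apply: continuousM; last exact: cst_continuous.
  exact: (continuous_kernel_deriv r01).
rewrite (Rintegral_is_derive s0 d1 c1) (Rintegral_is_derive st d2 c2).
by rewrite mul0r kernel_prim0; ring.
Qed.

(** This is the second moment of int_0^t psi' W: the preceding covariance, integrated once more
    against psi'. *)
Lemma Rintegral_kernel_deriv_prim t : 0 <= t <= 1 ->
  \int[mu]_(s in `[0, t]) (kernel_deriv s * (s * kernel t - kernel_prim s)) =
  kernel t ^+ 2 * t - 2 * kernel t * kernel_prim t + (horizon t)^-1 - 1.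
Proof.
move=> /andP[t0 t1].
(* Integration by parts in both terms; the second leaves the integral of psi^2, and psi^2 = L^2 /
   horizon^2 is the derivative of 1 / horizon. *)
pose F s := kernel t * (s * kernel s - kernel_prim s) -
  (kernel s * kernel_prim s - (horizon s)^-1).
have r01 r : 0 <= r <= t -> 0 <= r <= 1.
  by move=> /andP[-> rt]; rewrite (le_trans rt).
have dF r : 0 <= r <= t -> is_derive r (1 : R) F
    (kernel_deriv r * (r * kernel t - kernel_prim r)).
  move=> /r01 {}r01.
  have dk := is_derive_kernel r01; have dp := is_derive_kernel_prim r01.
  have di := is_derive_inv_horizon r01.
  have dB := is_deriveB (is_derive_mull (kernel t)
    (is_deriveB (is_derive_mulr (is_derive_id r (1 : R)) dk) dp))
    (is_deriveB (is_derive_mulr dk dp) di).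
  apply: (is_derive_eq dB); rewrite /kernel /kernel_deriv.
  have h0 := horizon_gt0 r01; have ht : 0 < horizon t by rewrite horizon_gt0 ?t0.
  by field; rewrite !gt_eqF.
have cF r : 0 <= r <= t ->
    {for r, continuous (fun r => kernel_deriv r * (r * kernel t - kernel_prim r))}.
  move=> /r01 {}r01; apply: continuousM; first exact: continuous_kernel_deriv.
  have ck := is_derive_continuous (is_derive_kernel_prim r01).
  apply: continuousB => //.
  by apply: continuousM; [exact: cvg_id|exact: cst_continuous].
rewrite (Rintegral_is_derive t0 dF cF).
by rewrite /F kernel_prim0 horizon0 invr1; ring.
Qed.

End kernels.

(* [Z] is the standardised signal (V - mu) / gamma, [W] the Brownian motion and
   [M] is alpha / (L sigma), for which [eqM] is the equilibrium equation. *)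
Section equilibrium_moments.
Context {d : measure_display} {T : measurableType d} {R : realType}.
Local Notation mu := (@lebesgue_measure R).
Local Notation RT := (measurableTypeR R).
Variables (P : probability T R) (L : R) (Z : T -> R) (W M : R -> T -> R).
Hypotheses (L0 : 0 < L) (L1 : L ^+ 2 < 1).
Hypotheses (cW : forall w, continuous (W^~ w))
  (mW : forall t, measurable_fun setT (W t)).
Hypotheses (cM : forall w, continuous (M^~ w))
  (mM : forall t, measurable_fun setT (M t)).
Hypothesis sW : forall t, 0 <= t <= 1 -> sq_integrable P (W t).
Hypothesis EWW : forall s t, 0 <= s <= 1 -> 0 <= t <= 1 ->
  \int[P]_w (W s w * W t w) = Num.min s t.
Hypotheses (sZ : sq_integrable P Z) (EZ2 : \int[P]_w (Z w ^+ 2) = 1).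
Hypothesis EWZ : forall t, 0 <= t <= 1 -> \int[P]_w (W t w * Z w) = 0.
Hypothesis eqM : forall w t, 0 <= t <= 1 ->
  horizon L t * M t w =
  Z w - L * W t w - L ^+ 2 * \int[mu]_(s in `[0, t]) M s w.

Local Notation q := (horizon L).
Local Notation psi := (kernel L).
Local Notation phi := (kernel_deriv L).
Local Notation Psi := (kernel_prim L).

Let A t w := \int[mu]_(s in `[0, t]) (phi s * W s w).

Let itv01 (r t : R) : t <= 1 -> 0 <= r -> r <= t -> 0 <= r <= 1.
Proof. by move=> t1 -> rt; rewrite (le_trans rt). Qed.

(* [(Z - L ^ 2 * int_0^t M) / horizon] is a primitive of [phi * W]. *)
Let AE t w : 0 <= t <= 1 -> A t w = M t w + psi t * W t w - Z w.
Proof.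
move=> t01; have [t0 t1] := andP t01.
(* Starting the integral at -1 makes every time of [[0, t]] interior, so that a two-sided derivative
   exists at 0 as well. *)
have int0 s : 0 <= s -> \int[mu]_(r in `[0, s]) M r w =
    \int[mu]_(r in `[-1, s]) M r w - \int[mu]_(r in `[-1, 0]) M r w.
  move=> s0; rewrite (@Rintegral_itv_split _ _ (-1) 0 s); first by rewrite addrC addKr.
    by rewrite s0 andbT; lra.
  by apply: integrable_itv => r _; exact: cM.
pose F s := (Z w - L ^+ 2 * (\int[mu]_(r in `[-1, s]) M r w -
   \int[mu]_(r in `[-1, 0]) M r w)) * (q s)^-1.
have dF s : 0 <= s <= t -> is_derive s (1 : R) F (phi s * W s w).
  move=> /andP[s0 st]; have s01 := itv01 t1 s0 st.
  have hs : -1 < s < 2 by apply/andP; split; lra.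
  have dN := is_deriveB (is_derive_Rintegral (@cM w) hs)
    (is_derive_cst (\int[mu]_(r in `[-1, 0]) M r w) s (1 : R)).
  have dG := is_derive_mulr
     (is_deriveB (is_derive_cst (Z w) s (1 : R)) (is_derive_mull (L ^+ 2) dN))
     (is_derive_inv_horizon L1 s01).
  apply: (is_derive_eq dG).
  have h0 := horizon_gt0 L1 s01.
  have := eqM w s01; rewrite (int0 _ s0) /=.
  rewrite !(sub0r, subr0) /kernel_deriv.
  set I := \int[mu]_(r in `[-1, s]) M r w - _; set m := M s w => E.
  (* The product rule gives L^2 / q^2 (Z - L^2 I - q m), and by the equilibrium equation the bracket
     is L W. *)
  have -> : L ^+ 3 / q s ^+ 2 * W s w = L ^+ 2 / q s ^+ 2 * (L * W s w).
    by field; rewrite gt_eqF.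
  have -> : L * W s w = Z w - q s * m - L ^+ 2 * I by rewrite E; ring.
  rewrite [X in X * _ + _](_ : _ = Z w - L ^+ 2 * I)//.
  by field; rewrite gt_eqF.
have cF s : 0 <= s <= t -> {for s, continuous (fun s => phi s * W s w)}.
  move=> /andP[s0 st]; have s01 := itv01 t1 s0 st.
  by apply: continuousM; [exact: continuous_kernel_deriv|exact: cW].
rewrite /A (Rintegral_is_derive t0 dF cF) /F subrr mulr0 subr0 horizon0 invr1 mulr1.
rewrite -(int0 t t0).
have h0 := horizon_gt0 L1 t01.
have -> : Z w - L ^+ 2 * \int[mu]_(r in `[0, t]) M r w =
    q t * M t w + L * W t w by rewrite (eqM w t01); ring.
by rewrite /kernel; field; rewrite gt_eqF.
Qed.

Let mA t : 0 <= t <= 1 -> measurable_fun setT (A t).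
Proof.
move=> t01.
rewrite (_ : A t = (fun w => M t w + psi t * W t w - Z w)); last first.
  by apply/funext => w; exact: AE.
apply: measurable_funB; last by case: sZ.
by apply: measurable_funD => //; exact: measurable_funM.
Qed.

Let EW2 t : 0 <= t <= 1 -> \int[P]_w (W t w ^+ 2) = t.
Proof. by move=> t01; rewrite EWW// minxx. Qed.

(* The sampling times are clamped so that the weight becomes continuous. *)
Let X (U : T -> R) s w := phi (clamp01 s) * (W s w * U w).

Let cphi : continuous (phi \o @clamp01 R).
Proof.
apply: continuous_comp_clamp01; apply: within_continuous_itv => x.
exact: continuous_kernel_deriv.
Qed.

Let cX U w : continuous ((X U)^~ w).
Proof.
move=> s; apply: (@continuousM _ _ (phi \o @clamp01 R) (fun s => W s w * U w)).
  exact: cphi.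
by apply: continuousM; [exact: cW|exact: cst_continuous].
Qed.

Let iWU U s : sq_integrable P U -> 0 <= s <= 1 ->
  P.-integrable setT (EFin \o (fun w => W s w * U w)).
Proof. by move=> sU s01; apply: sq_integrableM => //; exact: sW. Qed.

Let mX U : measurable_fun setT U ->
  measurable_fun setT (fun p : T * RT => X U p.2 p.1).
Proof.
move=> mU; apply: measurable_continuous_process => [t|w].
  by apply: measurable_funM => //; exact: measurable_funM.
exact: cX.
Qed.

Let iX U s : sq_integrable P U -> 0 <= s <= 1 ->
  P.-integrable setT (EFin \o X U s).
Proof. by move=> sU s01; apply: integrable_EFinZ => //; exact: iWU. Qed.

Let bX U s : sq_integrable P U -> 0 <= s <= 1 ->
  \int[P]_w `|X U s w| <= phi 1 * (1 + \int[P]_w (U w ^+ 2)).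
Proof.
move=> sU s01; have iS := integrable_sqrD (sW s01) sU.
have iU : P.-integrable setT (EFin \o (fun w => U w ^+ 2)) by case: sU.
have iW2 : P.-integrable setT (EFin \o (fun w => W s w ^+ 2)) by case: (sW s01).
apply: (@le_trans _ _ (\int[P]_w (phi 1 * (W s w ^+ 2 + U w ^+ 2)))).
  apply: le_Rintegral => //.
  - by have /integrable_norm := iX sU s01.
  - exact: integrable_EFinZ.
  move=> w _; rewrite normrM ger0_norm ?kernel_deriv_ge0//.
  rewrite ler_pM ?kernel_deriv_ge0 ?clamp01_id ?kernel_deriv_le//.
  rewrite normrM -(real_normK (num_real (W s w))) -(real_normK (num_real (U w))).
  have := sqr_ge0 (`|W s w| - `|U w|).
  have := mulr_ge0 (normr_ge0 (W s w)) (normr_ge0 (U w)).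
  nra.
rewrite RintegralZl// RintegralD// EW2//.
rewrite ler_wpM2l ?kernel_deriv_ge0// lerD2r.
by have /andP[] := s01.
Qed.

(** Fubini. Taking U to be [W s], [Z] and, once it is known to be square integrable, [A t] itself
    yields all the covariances of A. *)
Let EAU U t : sq_integrable P U -> 0 <= t <= 1 ->
  P.-integrable setT (EFin \o (fun w => A t w * U w)) /\
  \int[P]_w (A t w * U w) =
  \int[mu]_(s in `[0, t]) (phi s * \int[P]_w (W s w * U w)).
Proof.
move=> sU t01; have [t0 t1] := andP t01.
have AU w : A t w * U w = \int[mu]_(s in `[0, t]) X U s w.
  rewrite /A -RintegralZr//; last first.
    apply: integrable_itv => s /andP[s0 st]; have s01 := itv01 t1 s0 st.
    by apply: continuousM; [exact: continuous_kernel_deriv|exact: cW].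
  apply: eq_Rintegral => s /set_mem/=; rewrite in_itv/= => /andP[s0 st].
  by rewrite /X clamp01_id ?mulrA//; exact: (itv01 t1 s0 st).
have p1 w : mu.-integrable `[0, t] (EFin \o ((X U)^~ w)).
  by apply: integrable_itv => s _; exact: cX.
have p2 s : 0 <= s <= t -> P.-integrable setT (EFin \o X U s).
  by move=> /andP[s0 st]; apply: iX => //; exact: (itv01 t1 s0 st).
have p3 s : 0 <= s <= t ->
    \int[P]_w `|X U s w| <= phi 1 * (1 + \int[P]_w (U w ^+ 2)).
  by move=> /andP[s0 st]; apply: bX => //; exact: (itv01 t1 s0 st).
have mU := sq_integrable_mfun sU.
split.
  apply: eq_integrable (integrable_process_integral (mX mU) p1 p2 p3) => // w _.
  by rewrite /= AU.
under eq_Rintegral do rewrite AU.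
rewrite (Rintegral_process_integral (mX mU) p1 p2 p3).
apply: eq_Rintegral => s /set_mem/=; rewrite in_itv/= => /andP[s0 st].
have s01 := itv01 t1 s0 st.
by rewrite /X clamp01_id// RintegralZl//; exact: iWU.
Qed.

Let sA t : 0 <= t <= 1 -> sq_integrable P (A t).
Proof.
move=> t01; have [t0 t1] := andP t01; split; first exact: mA.
(* Jensen in time, Fubini for [(phi * W) ^ 2] *)
pose S s w := X (W s) s w * phi (clamp01 s).
have SE s w : S s w = (phi (clamp01 s) * W s w) ^+ 2 by rewrite /S /X; ring.
have cS w : continuous (S^~ w).
  move=> s; apply: (@continuousM _ _ (fun s => X (W s) s w) (phi \o @clamp01 R)); last exact: cphi.
  apply: (@continuousM _ _ (phi \o @clamp01 R) (fun s => W s w * W s w)).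
    exact: cphi.
  by apply: continuousM; exact: cW.
have mS : measurable_fun setT (fun p : T * RT => S p.2 p.1).
  apply: measurable_continuous_process => [s|//].
  by apply: measurable_funM => //; apply: measurable_funM => //; exact: measurable_funM.
have p1 w : mu.-integrable `[0, t] (EFin \o (S^~ w)).
  by apply: integrable_itv => s _; exact: cS.
have iS s : 0 <= s <= 1 -> P.-integrable setT (EFin \o S s).
  move=> s01; have := integrable_EFinZ measurableT (phi (clamp01 s)) (iX (sW s01) s01).
  by apply: eq_integrable => // w _ /=; rewrite /S mulrC.
have p2 s : 0 <= s <= t -> P.-integrable setT (EFin \o S s).
  by move=> /andP[s0 st]; apply: iS; exact: (itv01 t1 s0 st).
have p3 s : 0 <= s <= t -> \int[P]_w `|S s w| <= phi 1 ^+ 2.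
  move=> /andP[s0 st]; have s01 := itv01 t1 s0 st.
  have iW2 : P.-integrable setT (EFin \o (fun w => W s w ^+ 2)) by case: (sW s01).
  have -> : (fun w => `|S s w|) = (fun w => phi s ^+ 2 * W s w ^+ 2).
    by apply/funext => w; rewrite SE ger0_norm ?sqr_ge0// clamp01_id// exprMn.
  rewrite RintegralZl// EW2// -[leRHS]mulr1 ler_pM ?sqr_ge0//.
    by rewrite lerXn2r ?nnegrE ?kernel_deriv_ge0 ?kernel_deriv_le.
  by have /andP[] := s01.
apply: (@integrable_EFin_le _ _ _ P setT measurableT (fun w => A t w ^+ 2)
  (fun w => \int[mu]_(s in `[0, t]) S s w)).
- exact: (measurable_funX 2 (mA t01)).
- exact: (integrable_process_integral mS p1 p2 p3).
move=> w; rewrite ger0_norm ?sqr_ge0// /A.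
have cf s : 0 <= s <= t -> {for s, continuous (fun s => phi s * W s w)}.
  move=> /andP[s0 st]; have s01 := itv01 t1 s0 st.
  by apply: continuousM; [exact: continuous_kernel_deriv|exact: cW].
have t0' : 0 <= t <= 0 + 1 by rewrite t0 add0r.
apply: (le_trans (sqr_Rintegral_itv_le t0' cf)).
rewrite le_eqVlt; apply/orP; left; apply/eqP.
apply: eq_Rintegral => s /set_mem/=; rewrite in_itv/= => /andP[s0 st].
by rewrite SE clamp01_id//; exact: (itv01 t1 s0 st).
Qed.

Let EWA s t : 0 <= s -> s <= t -> t <= 1 ->
  \int[P]_w (W s w * A t w) = s * psi t - Psi s.
Proof.
move=> s0 st t1.
have s01 := itv01 t1 s0 st.
have t01 : 0 <= t <= 1 by rewrite t1 (le_trans s0).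
under eq_Rintegral do rewrite mulrC.
rewrite (EAU (sW s01) t01).2 -(Rintegral_kernel_deriv_min L0 L1 s0 st t1).
apply: eq_Rintegral => r /set_mem/=; rewrite in_itv/= => /andP[r0 rt].
by rewrite EWW ?(itv01 t1 r0 rt)// minC.
Qed.

Let EAZ t : 0 <= t <= 1 -> \int[P]_w (A t w * Z w) = 0.
Proof.
move=> t01; rewrite (EAU sZ t01).2; have [t0 t1] := andP t01.
transitivity (\int[mu]_(s in `[0, t]) (0 : R)); last first.
  by rewrite Rintegral_cst// mul0r.
apply: eq_Rintegral => r /set_mem/=; rewrite in_itv/= => /andP[r0 rt].
by rewrite EWZ ?mulr0// (itv01 t1 r0 rt).
Qed.

Let EAA t : 0 <= t <= 1 -> \int[P]_w (A t w ^+ 2) =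
  psi t ^+ 2 * t - 2 * psi t * Psi t + (q t)^-1 - 1.
Proof.
move=> t01; have [t0 t1] := andP t01.
rewrite -Rintegral_kernel_deriv_prim//.
rewrite (EAU (sA t01) t01).2.
apply: eq_Rintegral => r /set_mem/=; rewrite in_itv/= => /andP[r0 rt].
by rewrite EWA.
Qed.

Let ME t : 0 <= t <= 1 -> M t = (fun w => Z w - psi t * W t w + A t w).
Proof. by move=> t01; apply/funext => w; rewrite AE//; ring. Qed.

Lemma sq_integrable_equilibrium t : 0 <= t <= 1 -> sq_integrable P (M t).
Proof.
move=> t01; rewrite ME//; apply: sq_integrableD; last exact: sA.
by apply: sq_integrableB => //; apply: sq_integrableZ; exact: sW.
Qed.

(** The value is 1 + int_0^t psi^2, as Ito's isometry predicts. It is obtained by expanding the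
    square of Z - psi W + A, where all terms in t psi^2 and psi Psi cancel. *)
Lemma Rintegral_equilibrium_sqr t : 0 <= t <= 1 ->
  \int[P]_w (M t w ^+ 2) = (q t)^-1.
Proof.
move=> t01; have [t0 t1] := andP t01.
have sWt := sW t01; have sAt := sA t01.
have iZ2 : P.-integrable setT (EFin \o (fun w => Z w ^+ 2)) by case: sZ.
have iA2 : P.-integrable setT (EFin \o (fun w => A t w ^+ 2)) by case: sAt.
have iW2 : P.-integrable setT (EFin \o (fun w => W t w ^+ 2)) by case: sWt.
have iWZ := sq_integrableM sWt sZ; have iAZ := sq_integrableM sAt sZ.
have iWA := sq_integrableM sWt sAt.
have -> : (fun w => M t w ^+ 2) = (fun w => Z w ^+ 2 +
   (psi t ^+ 2 * W t w ^+ 2 + (A t w ^+ 2 + (2 * (A t w * Z w) +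
   ((- 2 * psi t) * (W t w * Z w) + (- 2 * psi t) * (W t w * A t w)))))).
  by rewrite ME//; apply/funext => w; ring.
have iZ' := fun c X i => @integrable_EFinZ _ _ _ P setT measurableT c X i.
have iD' := fun X Y i j => @integrable_EFinD _ _ _ P setT measurableT X Y i j.
have iWZ' := iZ' (- 2 * psi t) _ iWZ; have iWA' := iZ' (- 2 * psi t) _ iWA.
have iAZ' := iZ' 2 _ iAZ; have iW2' := iZ' (psi t ^+ 2) _ iW2.
have i1 := iD' _ _ iWZ' iWA'; have i2 := iD' _ _ iAZ' i1.
have i3 := iD' _ _ iA2 i2; have i4 := iD' _ _ iW2' i3.
rewrite !RintegralD// !RintegralZl// EZ2 EW2// EAA// EAZ// EWZ// EWA//.
ring.
Qed.

(** The covariance - t psi + (t psi - Psi) reduces to - Psi, minus the integral of psi. *)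
Lemma Rintegral_noise_equilibrium t : 0 <= t <= 1 ->
  \int[P]_w (W t w * M t w) = ln (q t) / L.
Proof.
move=> t01; have [t0 t1] := andP t01.
have sWt := sW t01; have sAt := sA t01.
have iW2 : P.-integrable setT (EFin \o (fun w => W t w ^+ 2)) by case: sWt.
have iWZ := sq_integrableM sWt sZ; have iWA := sq_integrableM sWt sAt.
have -> : (fun w => W t w * M t w) =
   (fun w => W t w * Z w + ((- psi t) * W t w ^+ 2 + W t w * A t w)).
  by rewrite ME//; apply/funext => w; ring.
have iZ' := fun c X i => @integrable_EFinZ _ _ _ P setT measurableT c X i.
have iD' := fun X Y i j => @integrable_EFinD _ _ _ P setT measurableT X Y i j.
have iW2' := iZ' (- psi t) _ iW2; have i1 := iD' _ _ iW2' iWA.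
rewrite !RintegralD// RintegralZl// EWZ// EW2// EWA// /kernel_prim; ring.
Qed.

End equilibrium_moments.

Section cutoff.
Context {d : measure_display} {T : measurableType d} {R : realType}.
Variables (G : set T) (X : R -> T -> R).

(* Paths are only almost surely continuous. Annihilating them outside of a set
   of good outcomes and freezing them outside of [0, 1] makes all of them
   continuous, hence the process jointly measurable. *)
Definition cutoff t w : R := \1_G w * X (clamp01 t) w.

Lemma cutoffE t w : G w -> 0 <= t <= 1 -> cutoff t w = X t w.
Proof. by move=> Gw t01; rewrite /cutoff indicE mem_set// mul1r clamp01_id. Qed.

Lemma cutoff_out t w : ~ G w -> cutoff t w = 0.
Proof. by move=> Gw; rewrite /cutoff indicE memNset// mul0r. Qed.

Lemma measurable_cutoff t : measurable G ->
  (forall s, 0 <= s <= 1 -> measurable_fun setT (X s)) ->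
  measurable_fun setT (cutoff t).
Proof.
move=> mG mX; apply: measurable_funM; first exact: measurable_indic.
exact: mX (clamp01_itv t).
Qed.

Lemma continuous_cutoff w :
  (G w -> {within `[0, 1], continuous (X^~ w)}) -> continuous (cutoff^~ w).
Proof.
move=> cX; have [Gw|Gw] := pselect (G w).
  have -> : cutoff^~ w = (X^~ w) \o @clamp01 R.
    by apply/funext => t; rewrite /cutoff indicE mem_set// mul1r.
  exact: continuous_comp_clamp01 (cX Gw).
have -> : cutoff^~ w = cst 0 by apply/funext => t; rewrite cutoff_out.
by move=> t; exact: cst_continuous.
Qed.

End cutoff.

(** * Expected wealths in equilibrium *)

Section equilibrium.
Context {d : measure_display} {T : measurableType d} {R : realType}.
Local Notation mu := (@lebesgue_measure R).
Local Notation RT := (measurableTypeR R).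
Variables (P : probability T R) (m gamma sigma kappa : R).
Variables (V : {RV P >-> R}) (B Y : R -> {RV P >-> R}).
Hypotheses (gamma0 : 0 < gamma) (sigma0 : 0 < sigma) (kappa0 : 0 < kappa).
Hypothesis hV : is_normal P V m gamma.
Hypothesis hB : brownian_motion B.
Hypothesis hVB : independent_systems P (sigma_var V) (sigma_process `[0, 1] B).
Local Notation L := (Lambda kappa).
Local Notation q := (horizon L).
Local Notation alpha := (trading_rate m gamma sigma V kappa Y).

Let L0 : 0 < L. Proof. exact: Lambda_gt0. Qed.
Let L1 : L ^+ 2 < 1. Proof. exact: sqr_Lambda_lt1. Qed.

(** The set of these outcomes need not be measurable; [G] below is a measurable subset of it of full
    measure. *)
Definition regular_path w : Prop :=
  [/\ {within `[0, 1], continuous (fun t => B t w)},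
      {within `[0, 1], continuous (fun t => Y t w)}
    & forall t, 0 <= t <= 1 ->
        Y t w = insider_demand m gamma sigma V kappa Y t w + sigma * B t w].

Variable G : set T.
Hypotheses (mG : measurable G) (aeG : {ae P, forall w, G w}).
Hypothesis regG : forall w, G w -> regular_path w.

Let Vstd w := (V w - m) / gamma.
Let signal t w := (Vstd w - L * Y t w / sigma) / q t.
Local Notation W := (cutoff G B).
Local Notation M := (cutoff G signal).
Let Z w := \1_G w * Vstd w.

Let cW w : continuous (W^~ w).
Proof. by apply: continuous_cutoff => /regG[]. Qed.

Let mW t : measurable_fun setT (W t).
Proof. exact: measurable_cutoff. Qed.

Let mVstd : measurable_fun setT Vstd.
Proof. by apply: measurable_funM => //; exact: measurable_funB. Qed.

Let mM t : measurable_fun setT (M t).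
Proof.
apply: measurable_cutoff => // s s01; apply: measurable_funM => //.
apply: measurable_funB => //; apply: measurable_funM => //.
exact: measurable_funM.
Qed.

Let continuous_horizon : continuous q.
Proof. by move=> t; exact: is_derive_continuous (is_derive_horizon L t). Qed.

Let cM w : continuous (M^~ w).
Proof.
apply: continuous_cutoff => /regG[_ cY _].
apply/subspace_continuousP => t t01; apply: cvgM.
  apply: cvgB; first exact: cvg_cst.
  apply: cvgM; last exact: cvg_cst.
  by apply: cvgM; [exact: cvg_cst|move/subspace_continuousP: cY; exact].
apply: cvgV; last by apply: cvg_within_filter; exact: continuous_horizon.
by rewrite gt_eqF// horizon_gt0//; move: t01; rewrite /= in_itv.
Qed.

Let alphaE w t : G w -> 0 <= t <= 1 -> alpha t w = L * sigma * M t w.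
Proof. by move=> Gw t01; rewrite cutoffE. Qed.

Let eqM w t : 0 <= t <= 1 ->
  q t * M t w = Z w - L * W t w - L ^+ 2 * \int[mu]_(s in `[0, t]) M s w.
Proof.
move=> t01; have [t0 t1] := andP t01.
(* Outside of [G] both sides vanish; this is why [Z] carries the indicator. *)
have [Gw|Gw] := pselect (G w); last first.
  rewrite /Z !cutoff_out// indicE memNset//.
  under eq_Rintegral do rewrite cutoff_out//.
  by rewrite Rintegral_cst// !(mul0r, mulr0) !subr0.
have [_ _ /(_ _ t01) YE] := regG Gw.
rewrite !cutoffE// /signal /Z indicE mem_set// mul1r YE.
have -> : insider_demand m gamma sigma V kappa Y t w =
    L * sigma * \int[mu]_(s in `[0, t]) M s w.
  rewrite -RintegralZl//; last by apply: integrable_itv => s _; exact: cM.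
  apply: eq_Rintegral => s /set_mem/=; rewrite in_itv/= => /andP[s0 st].
  by rewrite -alphaE// s0 (le_trans st).
have h0 := horizon_gt0 L1 t01.
by field; rewrite !gt_eqF.
Qed.

Let WB t : 0 <= t <= 1 -> {ae P, forall w, B t w = W t w}.
Proof. by move=> t01; apply: filterS aeG => w Gw; rewrite cutoffE. Qed.

Let ZV : {ae P, forall w, Vstd w = Z w}.
Proof. by apply: filterS aeG => w Gw; rewrite /Z indicE mem_set// mul1r. Qed.

Let sW t : 0 <= t <= 1 -> sq_integrable P (W t).
Proof.
move=> t01; apply: sq_integrable_ae (WB t01) _; first exact: mW.
exact: sq_integrable_brownian.
Qed.

Let EWW s t : 0 <= s <= 1 -> 0 <= t <= 1 ->
  \int[P]_w (W s w * W t w) = Num.min s t.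
Proof.
move=> s01 t01; rewrite -(Rintegral_brownianM hB hVB s01 t01).
apply: eq_Rintegral_ae; apply: filterS2 (WB s01) (WB t01) => w.
by move=> -> ->.
Qed.

Let sV : sq_integrable P (fun w => V w - m).
Proof.
split; first exact: measurable_funB.
exact: (is_normal_integrable (measurable_funPT V) hV (normal_sq_integrable m gamma0).2).
Qed.

Let sVstd : sq_integrable P Vstd.
Proof.
have := sq_integrableZ gamma^-1 sV.
by congr sq_integrable; apply/funext => w; rewrite /Vstd mulrC.
Qed.

Let sZ : sq_integrable P Z.
Proof.
apply: sq_integrable_ae ZV sVstd.
by apply: measurable_funM => //; exact: measurable_indic.
Qed.

Let EZ2 : \int[P]_w (Z w ^+ 2) = 1.
Proof.
transitivity (\int[P]_w (Vstd w ^+ 2)).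
  by apply: eq_Rintegral_ae; apply: filterS ZV => w ->.
transitivity (\int[P]_w (gamma ^- 2 * (V w - m) ^+ 2)).
  by apply: eq_Rintegral => w _; rewrite /Vstd expr_div_n mulrC.
rewrite RintegralZl//; last by case: sV.
rewrite (is_normal_Rintegral (measurable_funPT V) hV (normal_sq_integrable m gamma0).2).
by rewrite normal_variance// mulVf// gt_eqF// exprn_gt0.
Qed.

Let EWZ t : 0 <= t <= 1 -> \int[P]_w (W t w * Z w) = 0.
Proof.
move=> t01.
rewrite -(@Rintegral_price_brownian _ _ _ _ V B hB hVB Vstd t t01 mVstd).
- apply: eq_Rintegral_ae; apply: filterS2 (WB t01) ZV => w.
  by move=> -> ->.
- exact: sq_integrable_integrable.
- apply: (@sigma_var_comp _ _ _ (fun x => (x - m) / gamma) V).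
  by apply: measurable_funM => //; exact: measurable_funB.
Qed.

Let sM t : 0 <= t <= 1 -> sq_integrable P (M t).
Proof.
exact: (sq_integrable_equilibrium L0 L1 cW mW cM mM sW EWW sZ eqM).
Qed.

Let EM2 t : 0 <= t <= 1 -> \int[P]_w (M t w ^+ 2) = (q t)^-1.
Proof.
exact: (Rintegral_equilibrium_sqr L0 L1 cW mW cM mM sW EWW sZ EZ2 EWZ eqM).
Qed.

Let EWM t : 0 <= t <= 1 -> \int[P]_w (W t w * M t w) = ln (q t) / L.
Proof.
exact: (Rintegral_noise_equilibrium L0 L1 cW mW cM mM sW EWW sZ EWZ eqM).
Qed.

Let EM2_le t : 0 <= t <= 1 -> (q t)^-1 <= (1 - L ^+ 2)^-1.
Proof.
move=> t01; rewrite lef_pV2 ?posrE ?horizon_gt0 ?subr_gt0//.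
exact: horizon_ge.
Qed.

Section weighted.
Variable c : R -> R.
Hypotheses (cc : continuous c) (c1 : forall t, 0 <= t <= 1 -> `|c t| <= 1).

(** Used with the weight [q] for the trading gains, where V - S_t is proportional to q M, and with
    the weight 1 for the penalty. *)
Let S t w := c t * M t w ^+ 2.

Let cS w : continuous (S^~ w).
Proof.
move=> t; apply: (@continuousM _ _ c (fun t => M t w ^+ 2)); first exact: cc.
by apply: (@continuousM _ _ (M^~ w) (M^~ w)); exact: cM.
Qed.

Let mS : measurable_fun setT (fun p : T * RT => S p.2 p.1).
Proof.
apply: measurable_continuous_process => // t.
by apply: measurable_funM => //; apply: measurable_funX; exact: mM.
Qed.

Let pS w : mu.-integrable `[0, 1] (EFin \o (S^~ w)).
Proof. by apply: integrable_itv => t _; exact: cS. Qed.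

Let iS t : 0 <= t <= 1 -> P.-integrable setT (EFin \o S t).
Proof. by move=> t01; apply: integrable_EFinZ => //; case: (sM t01). Qed.

Let bS t : 0 <= t <= 1 -> \int[P]_w `|S t w| <= (1 - L ^+ 2)^-1.
Proof.
move=> t01; apply: le_trans (EM2_le t01); rewrite -EM2//.
have [_ iM2] := sM t01.
apply: le_Rintegral => // [|w _]; first by have /integrable_norm := iS t01.
by rewrite normrM (ger0_norm (sqr_ge0 _)) ler_piMl ?sqr_ge0 ?c1.
Qed.

Lemma integrable_weighted :
  P.-integrable setT (EFin \o (fun w => \int[mu]_(t in `[0, 1]) S t w)).
Proof. exact: (integrable_process_integral mS pS iS bS). Qed.

Lemma Rintegral_weighted :
  \int[P]_w \int[mu]_(t in `[0, 1]) S t w = \int[mu]_(t in `[0, 1]) (c t / q t).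
Proof.
rewrite (Rintegral_process_integral mS pS iS bS).
apply: eq_Rintegral => t /set_mem/=; rewrite in_itv/= => t01.
by rewrite RintegralZl// ?EM2//; case: (sM t01).
Qed.

End weighted.

Let cst1_le (t : R) : 0 <= t <= 1 -> `|cst (1 : R) t| <= 1.
Proof. by rewrite /cst normr1. Qed.

Let cst1_continuous : continuous (cst (1 : R) : R -> R).
Proof. by move=> t; exact: cst_continuous. Qed.

Let horizon_le1 t : 0 <= t <= 1 -> `|q t| <= 1.
Proof.
move=> t01; rewrite ger0_norm ?(ltW (horizon_gt0 L1 t01))// /horizon gerBl.
by have /andP[t0 _] := t01; rewrite mulr_ge0// sqr_ge0.
Qed.

Let int01 (c : R) : \int[mu]_(t in `[0, 1]) c = c.
Proof.
by rewrite Rintegral_cst//= lebesgue_measure_itv/= lte_fin ltr01 oppr0 adde0/= mulr1.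
Qed.

Let Rintegral_inv_horizon :
  \int[mu]_(t in `[0, 1]) (1 / q t) = - ln (1 - L ^+ 2) / L ^+ 2.
Proof.
have dF (t : R) : 0 <= t <= 1 -> is_derive t (1 : R)
    (fun t => L^-1 * kernel_prim L t) (1 / q t).
  move=> t01; apply: (is_derive_eq (is_derive_mull L^-1 (is_derive_kernel_prim L0 L1 t01))).
  have h0 := horizon_gt0 L1 t01.
  by rewrite /kernel; field; rewrite !gt_eqF.
have cF (t : R) : 0 <= t <= 1 -> {for t, continuous (fun t => 1 / q t)}.
  move=> t01; apply: continuousM; first exact: cst_continuous.
  exact: is_derive_continuous (is_derive_inv_horizon L1 t01).
rewrite (Rintegral_is_derive ler01 dF cF) kernel_prim0 mulr0 subr0.
by rewrite /kernel_prim /horizon mul1r; field; rewrite gt_eqF.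
Qed.

Let is_derive_ln_horizon (t : R) : 0 <= t <= 1 ->
  is_derive t (1 : R) (fun t => ln (q t)) ((q t)^-1 * - L ^+ 2).
Proof.
move=> t01; have h0 := horizon_gt0 L1 t01.
exact: (@is_derive1_comp _ _ _ _ _ _ (is_derive1_ln h0) (is_derive_horizon L t)).
Qed.

Let continuous_ln_horizon (t : R) : 0 <= t <= 1 ->
  {for t, continuous (fun t => ln (q t))}.
Proof. by move=> t01; exact: is_derive_continuous (is_derive_ln_horizon t01). Qed.

Let Rintegral_ln_horizon : \int[mu]_(t in `[0, 1]) ln (q t) =
  - ((1 - L ^+ 2) * ln (1 - L ^+ 2)) / L ^+ 2 - 1.
Proof.
(* Up to a constant, x ln x - x at x = q t, divided by the slope - L^2 of q. *)
pose F t := - L ^- 2 * (q t * ln (q t)) - t.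
have dF (t : R) : 0 <= t <= 1 -> is_derive t (1 : R) F (ln (q t)).
  move=> t01; have h0 := horizon_gt0 L1 t01.
  have dl := is_derive_ln_horizon t01.
  have dB := is_deriveB (is_derive_mull (- L ^- 2)
    (is_derive_mulr (is_derive_horizon L t) dl)) (is_derive_id t (1 : R)).
  by apply: (is_derive_eq dB); field; rewrite !gt_eqF.
rewrite (Rintegral_is_derive ler01 dF continuous_ln_horizon) /F horizon0 ln1 /horizon !mul1r.
by ring.
Qed.

Let price_gap w t : G w -> 0 <= t <= 1 ->
  V w - price m gamma sigma kappa Y t w = gamma * (q t * M t w).
Proof.
move=> Gw t01; have h0 := horizon_gt0 L1 t01.
rewrite /price /kyle_lambda cutoffE// /signal /Vstd.
by field; rewrite !gt_eqF.
Qed.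

Let insider_wealthE w : G w ->
  insider_wealth m gamma sigma V kappa Y w =
  gamma * sigma * L * \int[mu]_(t in `[0, 1]) (q t * M t w ^+ 2) -
  kappa * gamma * sigma * L ^+ 2 / 2 *
  \int[mu]_(t in `[0, 1]) (cst 1 t * M t w ^+ 2).
Proof.
move=> Gw; have cS (c : R -> R) : continuous c ->
    mu.-integrable `[0, 1] (EFin \o (fun t => c t * M t w ^+ 2)).
  move=> cc; apply: integrable_itv => t _.
  apply: (@continuousM _ _ c (fun t => M t w ^+ 2)); first exact: cc.
  by apply: (@continuousM _ _ (M^~ w) (M^~ w)); exact: cM.
have iq := cS _ continuous_horizon; have i1 := cS _ cst1_continuous.
rewrite /insider_wealth /penalty_rate.
rewrite -[in RHS]RintegralZl//; congr (_ - _).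
  apply: eq_Rintegral => t /set_mem/=; rewrite in_itv/= => t01.
  by rewrite price_gap// alphaE//; ring.
rewrite (@eq_Rintegral _ _ _ mu _ (fun t => (L * sigma) ^+ 2 * (cst 1 t * M t w ^+ 2))).
  by rewrite RintegralZl//; field; rewrite gt_eqF.
by move=> t /set_mem/=; rewrite in_itv/= => t01; rewrite alphaE//= mul1r exprMn.
Qed.

(** The weight q cancels E[M^2] = 1 / q, so the trading gains amount to gamma sigma L; the logarithm
    comes from the penalty alone. *)
Lemma expectation_insider_wealth :
  'E_P[insider_wealth m gamma sigma V kappa Y]%E =
  (gamma * sigma / 2 * profit kappa)%:E.
Proof.
have iq := integrable_weighted continuous_horizon horizon_le1.
have i1 := integrable_weighted cst1_continuous cst1_le.
rewrite unlock (ae_eq_integralT (g := fun w =>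
  (gamma * sigma * L * \int[mu]_(t in `[0, 1]) (q t * M t w ^+ 2) -
  kappa * gamma * sigma * L ^+ 2 / 2 *
  \int[mu]_(t in `[0, 1]) (cst 1 t * M t w ^+ 2))%:E)); last first.
  by apply: filterS aeG => w Gw; rewrite insider_wealthE.
have iq' := integrable_EFinZ measurableT (gamma * sigma * L) iq.
have i1' := integrable_EFinZ measurableT (kappa * gamma * sigma * L ^+ 2 / 2) i1.
rewrite integrable_EFin_fin//; last exact: integrable_EFinB.
congr EFin; rewrite RintegralB// !RintegralZl//.
rewrite (Rintegral_weighted continuous_horizon horizon_le1).
rewrite (Rintegral_weighted cst1_continuous cst1_le) Rintegral_inv_horizon.
rewrite (@eq_Rintegral _ _ _ mu _ (fun=> 1)); last first.
  move=> t /set_mem/=; rewrite in_itv/= => t01.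
  by rewrite divff// gt_eqF// horizon_gt0.
rewrite int01 profitE; field.
by rewrite gt_eqF.
Qed.

Lemma integrable_trading_rate w : G w -> mu.-integrable `[0, 1]
  (EFin \o (fun t => kyle_lambda gamma sigma kappa * alpha t w)).
Proof.
move=> Gw; have iM : mu.-integrable `[0, 1] (EFin \o (M^~ w)).
  by apply: integrable_itv => t _; exact: cM.
apply: eq_integrable (integrable_EFinZ _
  (kyle_lambda gamma sigma kappa * (L * sigma)) iM) => //.
move=> t /set_mem/=; rewrite in_itv/= => t01.
by rewrite alphaE// -mulrA.
Qed.

(** The noise being additive, the volatility of the price is constant and its Ito integral is a
    multiple of the increment of B. Keeping [B 0] makes the identity exact on all of [G]. *)
Lemma price_dynamics w t : G w -> 0 <= t <= 1 ->
  price m gamma sigma kappa Y t w = price m gamma sigma kappa Y 0 w +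
  \int[mu]_(s in `[0, t]) (kyle_lambda gamma sigma kappa * alpha s w) +
  kyle_lambda gamma sigma kappa * sigma * (B t w - B 0 w).
Proof.
move=> Gw t01; have [t0 t1] := andP t01; have [_ _ hYw] := regG Gw.
have t001 : 0 <= (0 : R) <= 1 by rewrite lexx ler01.
rewrite /price !hYw// /insider_demand set_itv1 Rintegral_set1.
rewrite RintegralZl//; first by ring.
have iM : mu.-integrable `[0, t] (EFin \o (M^~ w)).
  by apply: integrable_itv => s _; exact: cM.
apply: eq_integrable (integrable_EFinZ _ (L * sigma) iM) => //.
move=> s /set_mem/=; rewrite in_itv/= => /andP[s0 st].
by rewrite alphaE// s0 (le_trans st).
Qed.

Let N t w := W t w * M t w.

Let cN w : continuous (N^~ w).
Proof.
by move=> t; apply: (@continuousM _ _ (W^~ w) (M^~ w)); [exact: cW|exact: cM].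
Qed.

Let mN : measurable_fun setT (fun p : T * RT => N p.2 p.1).
Proof.
apply: measurable_continuous_process => // t.
by apply: measurable_funM; [exact: mW|exact: mM].
Qed.

Let pN w : mu.-integrable `[0, 1] (EFin \o (N^~ w)).
Proof. by apply: integrable_itv => t _; exact: cN. Qed.

Let iN t : 0 <= t <= 1 -> P.-integrable setT (EFin \o N t).
Proof. by move=> t01; exact: sq_integrableM (sW t01) (sM t01). Qed.

Let bN t : 0 <= t <= 1 -> \int[P]_w `|N t w| <= 1 + (1 - L ^+ 2)^-1.
Proof.
move=> t01; have sWt := sW t01; have sMt := sM t01.
have iW2 : P.-integrable setT (EFin \o (fun w => W t w ^+ 2)) by case: sWt.
have iM2 : P.-integrable setT (EFin \o (fun w => M t w ^+ 2)) by case: sMt.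
apply: (@le_trans _ _ (\int[P]_w (W t w ^+ 2 + M t w ^+ 2))).
  apply: le_Rintegral => //.
  - by have /integrable_norm := iN t01.
  - exact: integrable_sqrD.
  move=> w _; rewrite normrM.
  rewrite -(real_normK (num_real (W t w))) -(real_normK (num_real (M t w))).
  have := sqr_ge0 (`|W t w| - `|M t w|).
  have := mulr_ge0 (normr_ge0 (W t w)) (normr_ge0 (M t w)).
  nra.
rewrite RintegralD// EM2// lerD ?EM2_le//.
have -> : \int[P]_w (W t w ^+ 2) = t by rewrite EWW// minxx.
by have /andP[] := t01.
Qed.

(** The drift part of int B dS, written with the cut-off processes so as to be measurable; it agrees
    with the original on [G]. *)
Definition noise_drift w :=
  kyle_lambda gamma sigma kappa * (L * sigma) * \int[mu]_(t in `[0, 1]) N t w.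

Lemma noise_driftE w : G w -> noise_drift w = \int[mu]_(t in `[0, 1])
  (B t w * (kyle_lambda gamma sigma kappa * alpha t w)).
Proof.
move=> Gw; rewrite /noise_drift -RintegralZl//.
apply: eq_Rintegral => t /set_mem/=; rewrite in_itv/= => t01.
by rewrite alphaE// /N [W t w]cutoffE//; ring.
Qed.

Lemma integrable_noise_drift_path w : G w -> mu.-integrable `[0, 1]
  (EFin \o (fun t => B t w * (kyle_lambda gamma sigma kappa * alpha t w))).
Proof.
move=> Gw; apply: eq_integrable (integrable_EFinZ _
  (kyle_lambda gamma sigma kappa * (L * sigma)) (pN w)) => //.
move=> t /set_mem/=; rewrite in_itv/= => t01.
by rewrite /= alphaE// /N [W t w]cutoffE//; congr EFin; ring.
Qed.

Lemma integrable_noise_drift : P.-integrable setT (EFin \o noise_drift).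
Proof.
by apply: integrable_EFinZ => //; exact: (integrable_process_integral mN pN iN bN).
Qed.

Lemma Rintegral_noise_drift : \int[P]_w noise_drift w =
  kyle_lambda gamma sigma kappa * sigma * \int[mu]_(t in `[0, 1]) ln (q t).
Proof.
rewrite RintegralZl//; last exact: (integrable_process_integral mN pN iN bN).
rewrite (Rintegral_process_integral mN pN iN bN).
rewrite (@eq_Rintegral _ _ _ mu _ (fun t => L^-1 * ln (q t))); last first.
  by move=> t /set_mem/=; rewrite in_itv/= => t01; rewrite EWM// mulrC.
rewrite RintegralZl//; first by field; rewrite gt_eqF.
by apply: integrable_itv => t t01; exact: continuous_ln_horizon.
Qed.

(** The terminal position contributes gamma sigma q ln q / L with q taken at time 1, the drift of
    int B dS contributes its opposite minus gamma sigma L, and J contributes nothing. *)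
Lemma expectation_noise_wealth (I J : T -> R) :
  {ae P, forall w, I w = \int[mu]_(t in `[0, 1])
     (B t w * (kyle_lambda gamma sigma kappa * alpha t w)) + J w} ->
  P.-integrable setT (EFin \o J) -> \int[P]_w J w = 0 ->
  'E_P[noise_wealth m gamma sigma V B kappa Y I]%E = (- (gamma * sigma * L))%:E.
Proof.
move=> hI iJ EJ.
have t1 : (0 <= (1 : R)) && ((1 : R) <= 1). by rewrite ler01 lexx.
have iN1 := iN t1; have iD := integrable_noise_drift.
rewrite unlock (ae_eq_integralT (g := fun w =>
  (gamma * sigma * q 1 * N 1 w + (sigma * noise_drift w + sigma * J w))%:E));
  last first.
  apply: filterS2 aeG hI => w Gw hw.
  rewrite /noise_wealth hw -noise_driftE// price_gap// /N [W 1 w]cutoffE//.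
  by congr EFin; ring.
have i1 := integrable_EFinZ measurableT (gamma * sigma * q 1) iN1.
have i2 := integrable_EFinZ measurableT sigma iD.
have i3 := integrable_EFinZ measurableT sigma iJ.
have i4 := integrable_EFinD measurableT i2 i3.
rewrite integrable_EFin_fin//; last exact: integrable_EFinD.
congr EFin; rewrite !RintegralD//.
rewrite (RintegralZl _ measurableT iN1) (RintegralZl _ measurableT iD).
rewrite (RintegralZl _ measurableT iJ) EJ EWM// Rintegral_noise_drift.
rewrite Rintegral_ln_horizon /kyle_lambda /horizon mul1r.
by field; rewrite !gt_eqF.
Qed.

End equilibrium.

(** * Ito integrals *)

Section ito_mean.
Context {d : measure_display} {T : measurableType d} {R : realType}.
Local Notation mu := (@lebesgue_measure R).
Variable P : probability T R.
Variables (V : {RV P >-> R}) (B : R -> {RV P >-> R}).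
Hypothesis hB : brownian_motion B.
Hypothesis hVB : independent_systems P (sigma_var V) (sigma_process `[0, 1] B).
Local Notation F := (insider_filtration V B).

Lemma insider_filtration_measurable t : F t `<=` measurable.
Proof.
apply: smallest_sub; first exact: sigma_algebra_measurable.
by move=> A [|[s _]]; exact: sigma_var_measurable.
Qed.

Lemma Rintegral_sum0 (n : nat) (X : nat -> T -> R) :
  (forall i, (i < n)%N -> P.-integrable setT (EFin \o X i) /\
     \int[P]_w X i w = 0) ->
  P.-integrable setT (EFin \o (fun w => \sum_(i < n) X i w)) /\
  \int[P]_w \sum_(i < n) X i w = 0.
Proof.
elim: n => [_|n IH h].
  under eq_fun do rewrite big_ord0.
  rewrite Rintegral_probability_cst; split => //.
  exact: (finite_measure_integrable_cst P 0).
have [i1 E1] := IH (fun i hi => h i (ltnW hi)).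
have [i2 E2] := h n (ltnSn n).
under eq_fun do rewrite big_ord_recr/=.
split; first exact: integrable_EFinD.
by rewrite RintegralD// E1 E2 addr0.
Qed.

Lemma is_elementary_itv (b : R) n u e i : is_elementary P F b n u e ->
  (i < n)%N -> [/\ 0 <= u i, u i <= u i.+1 & u i.+1 <= b].
Proof.
move=> [u0 um ub _].
have u_ge0 j : (j <= n)%N -> 0 <= u j.
  elim: j => [//|j IH jn]; apply: le_trans (um _ jn).
  exact: IH (ltnW jn).
have u_le j : (j <= n)%N -> u j <= b.
  move=> jn; rewrite -(subKn jn).
  elim: (n - j)%N => [|k IH]; first by rewrite subn0.
  (* Descending induction from the last point; once k reaches n the truncated subtraction stays at 0
     and nothing changes. *)
  have [nk|kn] := leqP n k.
    have /eqP -> : (n - k.+1 == 0)%N by rewrite subn_eq0 leqW.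
    by move: IH; have /eqP -> : (n - k == 0)%N by rewrite subn_eq0.
  apply: le_trans IH; rewrite -[in leRHS](subnSK kn); apply: um.
  by rewrite ltn_subrL (leq_ltn_trans _ kn).
by move=> hi; split; [exact: u_ge0 (ltnW hi)|exact: um|exact: u_le].
Qed.

Lemma elementary_integral_mean0 (b : R) n u e : b <= 1 ->
  is_elementary P F b n u e ->
  P.-integrable setT (EFin \o elementary_integral B n u e) /\
  \int[P]_w elementary_integral B n u e w = 0.
Proof.
move=> b1 he; apply: Rintegral_sum0 (fun i w => e i w * (B (u i.+1) w - B (u i) w)) _.
move=> i hi; have [ui0 uiS uSb] := is_elementary_itv he hi.
have uS1 := le_trans uSb b1.
have [_ _ _ /(_ _ hi)[eF ei2]] := he.
have me : measurable_fun setT (e i).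
  move=> _ A mA; apply: (@insider_filtration_measurable (u i)).
  by apply: eF; exists A.
have se : sq_integrable P (e i) by [].
have ei := sq_integrable_integrable se.
split; first exact: sq_integrableM se (sq_integrable_increment hB ui0 uiS uS1).
exact: (Rintegral_adapted_increment0 hB hVB ui0 uiS uS1 me ei eF).
Qed.

(** An elementary integral E has mean 0, so the squared mean of J is that of J - E, at most the mean
    of (J - E)^2, which can be made arbitrarily small. *)
Lemma ito_integral_mean0 (b : R) (H : R -> T -> R) (J : T -> R) : b <= 1 ->
  is_ito_integral P F B b H J ->
  P.-integrable setT (EFin \o J) /\ \int[P]_w J w = 0.
Proof.
move=> b1 [mJ [n [u [e [he _ cJ]]]]].
pose E k := elementary_integral B (n k) (u k) (e k).
have hE k := elementary_integral_mean0 b1 (he k).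
have mE k : measurable_fun setT (E k).
  by apply/measurable_EFinP; case/integrableP: (hE k).1.
have small (eps : R) : 0 < eps -> exists k,
    sq_integrable P (fun w => J w - E k w) /\
    \int[P]_w ((J w - E k w) ^+ 2) <= eps.
  (* Convergence in the extended reals also gives eventual finiteness, hence the square
     integrability of [J - E k]. *)
  move=> eps0; have /fine_cvgP[fin /cvgrPdist_le/(_ _ eps0) le] := cJ.
  have [k [fk lk]] : exists k, ((\int[P]_w ((J w - E k w) ^+ 2)%:E)%E \is a fin_num) /\
      `|0 - \int[P]_w ((J w - E k w) ^+ 2)| <= eps.
    by have [k _ h] := filterI fin le; exists k; have [] := h k (leqnn k).
  have mD : measurable_fun setT (fun w => J w - E k w) by exact: measurable_funB.
  exists k; split.
    split => //; apply/integrableP; split.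
      by apply/measurable_EFinP; exact: measurable_funX.
    under eq_integral do rewrite gee0_abs ?lee_fin ?sqr_ge0//.
    by move: fk; rewrite ge0_fin_numE// integral_ge0// => w _; rewrite lee_fin sqr_ge0.
  by apply: le_trans lk; rewrite sub0r normrN ler_norm.
have [k0 [s0 _]] := small 1 ltr01.
have iJ : P.-integrable setT (EFin \o J).
  have := integrable_EFinD measurableT (sq_integrable_integrable s0) (hE k0).1.
  by apply: eq_integrable => // w _ /=; rewrite subrK.
split => //; apply/eqP; rewrite -sqrf_eq0 eq_le sqr_ge0 andbT.
apply/ler_addgt0Pl => eps eps0; rewrite addr0.
have [k [sk hk]] := small _ eps0.
apply: le_trans hk; apply: le_trans (sqr_Rintegral_le sk).
by rewrite RintegralB// ?(hE k).2 ?subr0//; exact: (hE k).1.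
Qed.

End ito_mean.

(** * Ito integrals of a constant and of Brownian motion *)

Section ito_existence.
Context {d : measure_display} {T : measurableType d} {R : realType}.
Local Notation mu := (@lebesgue_measure R).
Local Notation RT := (measurableTypeR R).
Variable P : probability T R.
Variables (V : {RV P >-> R}) (B : R -> {RV P >-> R}).
Hypothesis hB : brownian_motion B.
Hypothesis hVB : independent_systems P (sigma_var V) (sigma_process `[0, 1] B).
Local Notation F := (insider_filtration V B).

Lemma sigma_var_cst (G : set (set T)) (c : R) : sigma_var (cst c : T -> R) `<=` <<s G >>.
Proof. by apply/sigma_varP; exact: measurable_cst. Qed.

(** Elementary processes live on right-open cells and miss the last time, a null set. *)
Lemma integral_itv_co_eq0 (f : R -> \bar R) (a b : R) :
  (forall s, a <= s < b -> f s = 0%E) -> (\int[mu]_(s in `[a, b]) f s = 0)%E.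
Proof.
move=> f0; rewrite (@ae_eq_integral_set _ _ _ mu _ _ (cst 0%E))//.
  by rewrite integral0.
exists [set b]; split => //; first exact: lebesgue_measure_set1.
move=> s /= /not_implyP[]; rewrite in_itv/= => /andP[sa sb] fs.
by apply: contrapT => /eqP sb'; apply: fs; rewrite f0// sa lt_neqAle sb'.
Qed.

Lemma ito_integral_cst (t c : R) : 0 <= t ->
  is_ito_integral P F B t (fun _ _ => c) (fun w => c * (B t w - B 0 w)).
Proof.
move=> t0; split; first by apply: measurable_funM => //; exact: measurable_funB.
exists (fun=> 1%N), (fun _ i => if i == 0%N then 0 else t), (fun _ _ _ => c).
split.
- move=> k; split => //= -[|//] _ /=; first by [].
  split; first exact: sigma_var_cst.
  exact: (finite_measure_integrable_cst P (c ^+ 2)).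
- rewrite [X in X @ _ --> _](_ : _ = cst 0%E); first exact: cvg_cst.
  apply/funext => k; rewrite /= integral0_eq// => w _.
  apply: integral_itv_co_eq0 => s st.
  rewrite /elementary_process big_ord_recl big_ord0/= addr0 indicE mem_set/=.
    by rewrite mulr1 subrr expr0n.
  by rewrite in_itv.
- rewrite [X in X @ _ --> _](_ : _ = cst 0%E); first exact: cvg_cst.
  apply/funext => k; rewrite /= integral0_eq// => w _.
  by rewrite /elementary_integral big_ord_recl big_ord0/= addr0 subrr expr0n.
Qed.

Let u (n i : nat) : R := i%:R / n%:R.

(** The cell that contains s has index the integer part of [s * n.+1%:R]; the time 1 lies in no
    cell. *)
Let elementary_process_sample (n : nat) s : 0 <= s < 1 ->
  exists i, [/\ (i < n.+1)%N, u n.+1 i <= s, s <= u n.+1 i + n.+1%:R^-1 &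
    forall (X : nat -> T -> R) w, elementary_process n.+1 (u n.+1) X s w = X i w].
Proof.
move=> /andP[s0 s1].
have n0 : 0 < n.+1%:R :> R by [].
have sn0 : 0 <= s * n.+1%:R by rewrite mulr_ge0.
have /andP[h1 h2] := truncn_itv sn0.
set i := Num.truncn (s * n.+1%:R) in h1 h2.
have lin : (i < n.+1)%N.
  rewrite -(@ltr_nat R); apply: (le_lt_trans h1).
  by rewrite gtr_pMl.
have mem j : (s \in (`[u n.+1 j, u n.+1 j.+1[ : interval R)) = (j == i).
  rewrite in_itv/= /u ler_pdivrMr// ltr_pdivlMr//.
  apply/idP/eqP => [/andP[j1 j2]|->]; last by rewrite h1 h2.
  apply/eqP; rewrite eqn_leq -ltnS -(@ltr_nat R) (le_lt_trans j1 h2)/=.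
  by rewrite -ltnS -(@ltr_nat R) (le_lt_trans h1 j2).
exists i; split => //.
- by rewrite /u ler_pdivrMr.
- by rewrite /u -[X in _ + X]mul1r -mulrDl ler_pdivlMr// natr1 ltW.
move=> X w; rewrite /elementary_process (bigD1 (Ordinal lin))//= big1 ?addr0.
  by rewrite indicE mem_set ?mulr1//= mem.
move=> j ji; rewrite indicE memNset ?mulr0//= mem.
by apply/negP; apply: contra ji => /eqP ji; apply/eqP/val_inj.
Qed.

Lemma subdivision_itv n i : (i < n.+1)%N ->
  [/\ 0 <= u n.+1 i, u n.+1 i < u n.+1 i.+1, u n.+1 i.+1 <= 1 &
      u n.+1 i.+1 - u n.+1 i = n.+1%:R^-1].
Proof.
move=> hi; have n0 : 0 < n.+1%:R :> R by [].
split.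
- by rewrite divr_ge0.
- by rewrite ltr_pM2r ?invr_gt0// ltr_nat.
- by rewrite ler_pdivrMr// mul1r ler_nat.
- by rewrite /u -mulrBl -natrB// subSnn mul1r.
Qed.

(** Centred squared increment: summed over all cells, it is the error made by replacing the
    quadratic variation of B over [[0, 1]] by 1. *)
Let xi n i w := (B (u n.+1 i.+1) w - B (u n.+1 i) w) ^+ 2 - n.+1%:R^-1.

Let sq_integrable_xi n i : (i < n.+1)%N -> sq_integrable P (xi n i) /\
  \int[P]_w (xi n i w ^+ 2) <= 29 * n.+1%:R^-1 ^+ 2.
Proof.
move=> /subdivision_itv[u0 /ltW uS u1 E].
have [i4 E4] := increment4 hB u0 uS u1.
have E2 := Rintegral_increment2 hB u0 uS u1.
have [mD iD2] := sq_integrable_increment hB u0 uS u1.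
set D := (fun w => _) in mD iD2.
have i4' : P.-integrable setT (EFin \o (fun w => D w ^+ 4)) := i4.
have sD2 : sq_integrable P (fun w => D w ^+ 2).
  split; first exact: measurable_funX.
  by apply: eq_integrable i4' => // w _ /=; rewrite -exprM.
split; first exact: sq_integrableB sD2 (sq_integrable_cst P _).
set h := n.+1%:R^-1 in E *.
have -> : (fun w => xi n i w ^+ 2) =
    (fun w => D w ^+ 4 + ((- 2 * h) * D w ^+ 2 + h ^+ 2)).
  by apply/funext => w; rewrite /xi -/h /D; ring.
have ic : P.-integrable setT (EFin \o (fun=> h ^+ 2)).
  exact: (finite_measure_integrable_cst P (h ^+ 2)).
have i1 := integrable_EFinZ measurableT (- 2 * h) iD2.
have i2 := integrable_EFinD measurableT i1 ic.
rewrite !RintegralD// RintegralZl// Rintegral_probability_cst E2 E.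
have := sqr_ge0 h; move: E4; rewrite E -/D => E4; lra.
Qed.

Let sigma_var_sum_xi n m : (m <= n.+1)%N ->
  sigma_var (fun w => \sum_(i < m) xi n i w) `<=` F (u n.+1 m).
Proof.
move=> mn; apply/sigma_varP; apply: measurable_sum => i.
have mB j : (j <= m)%N -> measurable_fun
    (setT : set (g_sigma_algebraType (sigma_var V `|`
       \bigcup_(s in `[0, u n.+1 m]) sigma_var (B s)))) (B (u n.+1 j)).
  move=> jm; apply/sigma_varP; apply: sub_insider_filtration.
  by rewrite divr_ge0//= ler_pM2r ?invr_gt0// ler_nat.
apply: measurable_funB => //; apply: measurable_funX; apply: measurable_funB.
  by apply: mB.
by apply: mB; exact: ltnW.
Qed.

(** Each [xi] is centred and independent of the past, so cross terms vanish and second moments add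
    up. Over all [n.+1] cells the bound is 29 / (n + 1), which tends to 0. *)
Let sum_xi n m : (m <= n.+1)%N ->
  sq_integrable P (fun w => \sum_(i < m) xi n i w) /\
  \int[P]_w ((\sum_(i < m) xi n i w) ^+ 2) <= 29 * n.+1%:R^-1 ^+ 2 * m%:R.
Proof.
elim: m => [_|m IH mn].
  under eq_fun do rewrite big_ord0.
  have -> : (fun w => (\sum_(i < 0) xi n i w) ^+ 2) = cst 0.
    by apply/funext => w; rewrite big_ord0 expr0n.
  rewrite Rintegral_probability_cst mulr0; split => //.
  exact: sq_integrable_cst.
have [sS ES] := IH (ltnW mn); have [sx Ex] := sq_integrable_xi mn.
under eq_fun do rewrite big_ord_recr/=.
split; first exact: sq_integrableD.
set S := fun w : T => \sum_(i < m) xi n i w in sS ES *.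
have -> : (fun w => (\sum_(i < m.+1) xi n i w) ^+ 2) =
    (fun w => S w ^+ 2 + (2 * (S w * xi n m w) + xi n m w ^+ 2)).
  by apply/funext => w; rewrite big_ord_recr/= /S; ring.
have [u0 uS u1 E] := subdivision_itv mn.
have iS2 : P.-integrable setT (EFin \o (fun w => S w ^+ 2)) by case: sS.
have ix2 : P.-integrable setT (EFin \o (fun w => xi n m w ^+ 2)) by case: sx.
have iSx := sq_integrableM sS sx.
have iSx' := integrable_EFinZ measurableT 2 iSx.
have i1 := integrable_EFinD measurableT iSx' ix2.
have [mD iD2] := sq_integrable_increment hB u0 (ltW uS) u1.
have ESx : \int[P]_w (S w * xi n m w) = 0.
  have mf : measurable_fun setT (fun x : R => x ^+ 2 - n.+1%:R^-1).
    by apply: measurable_funB => //; exact: measurable_funX.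
  have mS := sq_integrable_mfun sS; have iS := sq_integrable_integrable sS.
  have := Rintegral_adapted_increment hB hVB u0 u1 mS iS
    (sigma_var_sum_xi (ltnW mn)) mf (sq_integrable_integrable sx) uS.
  rewrite -/(xi n m) => ->.
  rewrite RintegralB//; last exact: (finite_measure_integrable_cst P n.+1%:R^-1).
  rewrite (Rintegral_increment2 hB u0 (ltW uS) u1) E Rintegral_probability_cst.
  by rewrite subrr mulr0.
rewrite !RintegralD// RintegralZl// ESx mulr0 add0r.
have -> : m.+1%:R = m%:R + 1 :> R by rewrite natr1.
rewrite [leRHS]mulrDr mulr1.
exact: lerD.
Qed.

(* Summation by parts: [2 b (b' - b) = b' ^ 2 - b ^ 2 - (b' - b) ^ 2] *)
Let elementary_integral_brownian (c : R) n w : B 0 w = 0 ->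
  c / 2 * (B 1 w ^+ 2 - 1) -
  elementary_integral B n.+1 (u n.+1) (fun i w => c * B (u n.+1 i) w) w =
  c / 2 * \sum_(i < n.+1) xi n i w.
Proof.
move=> B0; have n0 : n.+1%:R != 0 :> R by rewrite pnatr_eq0.
suff h m : elementary_integral B m (u n.+1) (fun i w => c * B (u n.+1 i) w) w =
    c / 2 * (B (u n.+1 m) w ^+ 2 - \sum_(i < m) xi n i w - m%:R / n.+1%:R).
  by rewrite h /u divff//; ring.
rewrite /elementary_integral; elim: m => [|m IH].
  by rewrite !big_ord0 /u !mul0r B0; ring.
rewrite !big_ord_recr/= IH /xi.
have -> : m.+1%:R = m%:R + 1 :> R by rewrite natr1.
by field.
Qed.

Let cvg0_harmonic (C : R) (a : nat -> \bar R) :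
  (forall k, 0 <= a k <= (C * k.+1%:R^-1)%:E)%E -> a @ \oo --> 0%E.
Proof.
move=> ha; apply: (@squeeze_cvge _ _ _ _ (cst 0%E) a (fun k => (C * k.+1%:R^-1)%:E)).
- by apply: nearW => k; exact: ha.
- exact: cvg_cst.
- apply: cvg_EFin; first exact: nearW.
  rewrite -(mulr0 C); apply: cvgM; first exact: cvg_cst.
  exact: cvg_harmonic.
Qed.

Let ito_integral_brownian_error (c : R) n :
  (\int[P]_w ((c / 2 * (B 1%R w ^+ 2 - 1) - elementary_integral B n.+1 (u n.+1)
      (fun i w => c * B (u n.+1 i) w) w) ^+ 2)%:E <=
   (c ^+ 2 / 4 * 29 * n.+1%:R^-1)%:E)%E.
Proof.
have [sS ES] := sum_xi (leqnn n.+1).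
have iS : P.-integrable setT (EFin \o (fun w => (\sum_(i < n.+1) xi n i w) ^+ 2)).
  by case: sS.
rewrite (@ae_eq_integralT _ _ _ P _
  (fun w => (c ^+ 2 / 4 * (\sum_(i < n.+1) xi n i w) ^+ 2)%:E)); last first.
  apply: filterS (brownian_eq0 hB) => w B0.
  by rewrite elementary_integral_brownian//; congr EFin; field.
rewrite integrable_EFin_fin//; last exact: integrable_EFinZ.
rewrite lee_fin RintegralZl// -[leRHS]mulrA ler_wpM2l ?divr_ge0 ?sqr_ge0//.
by apply: (le_trans ES); rewrite expr2 -!mulrA mulVf ?mulr1.
Qed.

Variable G : set T.
Hypotheses (mG : measurable G) (aeG : {ae P, forall w, G w}).
Hypothesis cB : forall w, G w -> {within `[0, 1], continuous (fun t => B t w)}.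

Let W := cutoff G B.

(** Integrand of the approximation error, with the cut-off process so that it is jointly measurable,
    and restricted to [[0, 1[], where some cell contains the time. *)
Let f (c : R) n (p : T * RT) : \bar R :=
  ((W p.2 p.1 * c - elementary_process n.+1 (u n.+1)
     (fun i w => c * W (u n.+1 i) w) p.2 p.1) ^+ 2 * \1_(`[0, 1[%classic) p.2)%:E.

Let mf c n : measurable_fun setT (f c n).
Proof.
have mW : measurable_fun setT (fun p : T * RT => W p.2 p.1).
  apply: measurable_continuous_process => [t|w].
    exact: measurable_cutoff.
  by apply: continuous_cutoff => /cB.
have m1 (A : set RT) : measurable A ->
    measurable_fun setT (fun p : T * RT => \1_A p.2 : R).
  by move=> mA; apply: measurableT_comp => //; exact: measurable_indic.
apply/measurable_EFinP; apply: measurable_funM; last exact: m1.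
apply: measurable_funX; apply: measurable_funB; first exact: measurable_funM.
apply: measurable_sum => i; apply: measurable_funM; last exact: m1.
apply: measurable_funM => //.
apply: (@measurableT_comp _ _ _ _ _ _ (W (u n.+1 i)) _ fst) => //.
exact: measurable_cutoff.
Qed.

Let f_ge0 c n p : (0 <= f c n p)%E.
Proof. by rewrite lee_fin mulr_ge0 ?sqr_ge0. Qed.

(** At a time s below 1, the error is c^2 times the variance of the increment of B since the left
    end of the cell of s, hence at most c^2 times the mesh. *)
Let int_f_le c n s : (\int[P]_w f c n (w, s) <=
  ((fun=> (c ^+ 2 * n.+1%:R^-1)%:E) \_ `[0%R, 1%R]) s)%E.
Proof.
rewrite patchE /f/= indicE.
have [s01|s01] := boolP (s \in `[0%R, 1%R[%classic); last first.
  under eq_integral do rewrite mulr0.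
  rewrite integral0; case: ifPn => // _.
  by rewrite lee_fin mulr_ge0 ?sqr_ge0 ?invr_ge0.
move: s01 => /set_mem/=; rewrite in_itv/= => s01; have [s0 s1] := andP s01.
rewrite mem_set/=; last by rewrite in_itv/= s0 ltW.
have [i [hi ui su EX]] := elementary_process_sample n s01.
have [u0 uS u1 _] := subdivision_itv hi.
have s01' : 0 <= s <= 1 by rewrite s0 ltW.
have u01 : 0 <= u n.+1 i <= 1 by rewrite u0 (le_trans (ltW uS)).
rewrite (@ae_eq_integralT _ _ _ P _
   (fun w => (c ^+ 2 * (B s w - B (u n.+1 i) w) ^+ 2)%:E)); last first.
  apply: filterS aeG => w Gw.
  by rewrite EX mulr1 /W !cutoffE//; congr EFin; ring.
have sI := sq_integrable_increment hB u0 ui (ltW s1).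
have iI2 : P.-integrable setT (EFin \o (fun w => (B s w - B (u n.+1 i) w) ^+ 2)).
  by case: sI.
rewrite integrable_EFin_fin//; last exact: integrable_EFinZ.
rewrite RintegralZl// (Rintegral_increment2 hB u0 ui (ltW s1)) lee_fin.
by rewrite ler_wpM2l ?sqr_ge0// lerBlDl.
Qed.

(** The formula int_0^1 B dB = (B_1^2 - 1) / 2, approximated by sampling B at the left ends of equal
    cells. With c the volatility of the price this is the Ito part of int B dS. *)
Lemma ito_integral_brownian (c : R) :
  is_ito_integral P F B 1 (fun s w => B s w * c) (fun w => c / 2 * (B 1 w ^+ 2 - 1)).
Proof.
split.
  apply: measurable_funM => //; apply: measurable_funB => //.
  exact: measurable_funX.
(* The approximation of index k has k + 1 cells, so that the mesh never divides by 0. *)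
exists S, (fun k => u k.+1), (fun k i w => c * B (u k.+1 i) w); split.
- move=> k; split.
  + by rewrite /u mul0r.
  + by move=> i /subdivision_itv[_ /ltW].
  + by rewrite /u divff.
  + move=> i hi; have [u0 uS u1 _] := subdivision_itv hi.
    have u01 : 0 <= u k.+1 i <= 1 by rewrite u0 (le_trans (ltW uS)).
    split; last first.
      by case: (sq_integrableZ c (sq_integrable_brownian hB u01)).
    apply: subset_trans (@sub_insider_filtration _ _ _ P V B (u k.+1 i) _ _).
      by apply: (@sigma_var_comp _ _ _ (fun x => c * x)); exact: measurable_funM.
    by rewrite u0 lexx.
- apply: (@cvg0_harmonic (c ^+ 2)) => k; apply/andP; split.
    by apply: integral_ge0 => w _; apply: integral_ge0 => s _; rewrite lee_fin sqr_ge0.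
  (* Off a null set of outcomes and off the time 1, the integrand is [f c k], to which Tonelli
     applies. *)
  rewrite (@ae_eq_integralT _ _ _ P _ (fun w => \int[mu]_s f c k (w, s))%E).
    rewrite (fubini_tonelli (f c k)); [|exact: mf|exact: f_ge0].
    apply: (@le_trans _ _ (\int[mu]_(s in `[0%R, 1%R]) (c ^+ 2 * k.+1%:R^-1)%:E)%E).
      rewrite [leRHS]integral_mkcond; apply: ge0_le_integral => //.
      - by move=> s _; apply: integral_ge0 => w _; exact: f_ge0.
      - by apply: (measurable_fun_fubini_tonelli_G (f c k)); [exact: mf|exact: f_ge0].
      - have mab : measurable (`[0, 1] : set RT) by exact: measurable_itv.
        by apply/(measurable_restrictT _ mab); exact: measurable_cst.
    by rewrite integral_cst//= lebesgue_measure_itv/= lte_fin ltr01 oppr0 adde0 mule1.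
  apply: filterS aeG => w Gw.
  rewrite integral_mkcond; apply: ae_eq_integralT.
  exists [set 1]; split => //; first exact: lebesgue_measure_set1.
  move=> s /= hs; apply: contrapT => s1; apply: hs.
  rewrite patchE /f/= indicE.
  have -> : (s \in `[0%R, 1%R]%classic) = (s \in `[0%R, 1%R[%classic).
    apply/idP/idP => /set_mem/=; rewrite in_itv/= => /andP[s0 hs1];
      apply/mem_set; rewrite /= in_itv/= s0/=; last exact: ltW.
    by rewrite lt_neqAle hs1 andbT; apply/eqP.
  have [s01|_] := boolP (s \in _); last by rewrite mulr0.
  move: s01 => /set_mem/=; rewrite in_itv/= => s01; have [s0 s1'] := andP s01.
  have [i [hi _ _ EX]] := elementary_process_sample k s01.
  have [u0 uS u1 _] := subdivision_itv hi.
  by rewrite !EX mulr1 /W !cutoffE// ?s0 ?u0 ?(ltW s1')// (le_trans (ltW uS)).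
- apply: (@cvg0_harmonic (c ^+ 2 / 4 * 29)) => k; apply/andP; split.
    by apply: integral_ge0 => w _; rewrite lee_fin sqr_ge0.
  exact: ito_integral_brownian_error.
Qed.

End ito_existence.

(** * Profit and welfare *)

Section welfare.
Context {d : measure_display} {T : measurableType d} {R : realType}.
Local Notation mu := (@lebesgue_measure R).
Variables (P : probability T R) (m gamma sigma kappa : R).
Variables (V : {RV P >-> R}) (B Y : R -> {RV P >-> R}).
Hypotheses (gamma0 : 0 < gamma) (sigma0 : 0 < sigma) (kappa0 : 0 < kappa).
Hypothesis hV : is_normal P V m gamma.
Hypothesis hB : brownian_motion B.
Hypothesis hVB : independent_systems P (sigma_var V) (sigma_process `[0, 1] B).
Hypothesis hY : is_equilibrium_demand m gamma sigma V B kappa Y.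

Lemma regular_paths : exists G : set T, [/\ measurable G, {ae P, forall w, G w}
  & forall w, G w -> regular_path m gamma sigma kappa V B Y w].
Proof.
have [cY eY] := hY; have [_ _ _ cB] := hB.
have [N [mN N0 sub]] : {ae P, forall w, regular_path m gamma sigma kappa V B Y w}.
  by apply: filterS3 cB cY eY => w.
exists (~` N); split; first exact: measurableC.
  by exists N; split => // w /=; exact: contrapT.
by move=> w; apply: contra_notP => h; exact: sub.
Qed.

Lemma expected_insider_wealth :
  'E_P[insider_wealth m gamma sigma V kappa Y]%E =
  (gamma * sigma / 2 * profit kappa)%:E.
Proof.
have [G [mG aeG regG]] := regular_paths.
exact: (expectation_insider_wealth gamma0 sigma0 kappa0 hV hB hVB mG aeG regG).
Qed.

(** Keeps the welfare claim, which quantifies over all versions I, from being vacuous. The witness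
    is the drift part plus lambda sigma (B_1^2 - 1) / 2. *)
Lemma exists_noise_gain : exists I, is_noise_gain m gamma sigma V B kappa Y I.
Proof.
have [G [mG aeG regG]] := regular_paths.
have cB w : G w -> {within `[0, 1], continuous (fun t => B t w)} by move=> /regG[].
pose c := kyle_lambda gamma sigma kappa * sigma.
pose D := noise_drift m gamma sigma kappa V B Y G.
pose J w := c / 2 * (B 1 w ^+ 2 - 1).
have mJ : measurable_fun setT J.
  apply: measurable_funM => //; apply: measurable_funB => //.
  exact: measurable_funX.
exists (fun w => D w + J w); split.
- split.
    apply: filterS aeG => w Gw; exact: (integrable_trading_rate kappa0 regG Gw).
  move=> t t01; have [t0 t1] := andP t01.
  exists (fun w => c * (B t w - B 0 w)); split.
    exact: ito_integral_cst.
  by apply: filterS aeG => w Gw; exact: (price_dynamics kappa0 regG Gw t01).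
- apply: measurable_funD => //; apply/measurable_EFinP.
  have := integrable_noise_drift gamma0 sigma0 kappa0 hV hB hVB mG aeG regG.
  by case/integrableP.
- by apply: filterS aeG => w Gw; exact: (integrable_noise_drift_path kappa0 regG Gw).
- exists J; split; first exact: (ito_integral_brownian hB hVB mG aeG cB c).
  by apply: filterS aeG => w Gw; rewrite /D (noise_driftE kappa0 regG Gw).
Qed.

Lemma expected_noise_wealth (I : T -> R) :
  is_noise_gain m gamma sigma V B kappa Y I ->
  'E_P[noise_wealth m gamma sigma V B kappa Y I]%E =
  (- (gamma * sigma * Lambda kappa))%:E.
Proof.
have [G [mG aeG regG]] := regular_paths.
move=> [_ _ _ [J [/(ito_integral_mean0 hB hVB (lexx 1)) [iJ EJ] hI]]].
exact: (expectation_noise_wealth gamma0 sigma0 kappa0 hV hB hVB mG aeG regG hI iJ EJ).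
Qed.

End welfare.

Theorem corollary5p4 (R : realType) (d : measure_display)
    (T : measurableType d) (P : probability T R) (mu gamma sigma : R)
    (V : {RV P >-> R}) (B : R -> {RV P >-> R}) (Y : R -> R -> {RV P >-> R})
    (hgamma : 0 < gamma) (hsigma : 0 < sigma)
    (hV : is_normal P V mu gamma)
    (hB : brownian_motion B)
    (hVB : independent_systems P (sigma_var V) (sigma_process `[0, 1] B))
    (hY : forall kappa, 0 < kappa ->
      is_equilibrium_demand mu gamma sigma V B kappa (Y kappa)) :
  [/\ (forall kappa, 0 < kappa ->
         'E_P[insider_wealth mu gamma sigma V kappa (Y kappa)]%E =
         (gamma * sigma / 2 *
          (kappa * ln (kappa * Lambda kappa) + 2 * Lambda kappa))%:E) /\
      [/\ convex_function (E := R^o) `]0, +oo[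
            (ex_ante_profit mu gamma sigma V Y),
          {in `]0, +oo[ &, forall kappa1 kappa2, kappa1 < kappa2 ->
             ex_ante_profit mu gamma sigma V Y kappa2 <
             ex_ante_profit mu gamma sigma V Y kappa1}
        & ex_ante_profit mu gamma sigma V Y kappa @[kappa --> +oo] --> 0],
      forall kappa : R, 0 < kappa ->
        is_derive kappa 1 (Lambda : R -> R)
          (- (Lambda kappa ^+ 2 / (1 + Lambda kappa ^+ 2)))
    & forall kappa, 0 < kappa ->
        (exists I, is_noise_gain mu gamma sigma V B kappa (Y kappa) I) /\
        (forall I, is_noise_gain mu gamma sigma V B kappa (Y kappa) I ->
           ('E_P[insider_wealth mu gamma sigma V kappa (Y kappa)] +
            'E_P[noise_wealth mu gamma sigma V B kappa (Y kappa) I])%E =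
           (gamma * sigma / 2 * (kappa * ln (kappa * Lambda kappa)))%:E) /\
        gamma * sigma / 2 * (kappa * ln (kappa * Lambda kappa)) =
        gamma * sigma / 2 * (kappa * ln (1 - Lambda kappa ^+ 2))].
Proof.
have gs0 : 0 < gamma * sigma / 2 by rewrite divr_gt0// mulr_gt0.
have EW kappa (kappa0 : 0 < kappa) :=
  expected_insider_wealth hgamma hsigma kappa0 hV hB hVB (hY _ kappa0).
have profitW kappa : 0 < kappa ->
    ex_ante_profit mu gamma sigma V Y kappa = gamma * sigma / 2 * profit kappa.
  by move=> kappa0; rewrite /ex_ante_profit EW.
have itv0y (x : R) : (x \in (`]0, +oo[ : interval R)) = (0 < x).
  by rewrite in_itv/= andbT.
split; [split; [exact: EW|split]|exact: is_derive_Lambda|].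
- move=> t x y /set_mem; rewrite /= itv0y => x0 /set_mem; rewrite /= itv0y => y0.
  have xy0 := convR_gt0 t x0 y0.
  rewrite profitW// [leRHS]convRE !profitW//.
  rewrite [X in profit X](_ : _ = t%:num * x + (1 - t%:num) * y)//.
  have t01 : 0 <= (t%:num : R) <= 1 by apply/andP.
  have [t0 t1] := andP t01.
  have := profit_convex t0 t1 x0 y0.
  rewrite -(ler_pM2l gs0) => h; apply: (le_trans h).
  by rewrite le_eqVlt; apply/orP; left; apply/eqP; rewrite /unstable.onem; ring.
- move=> k1 k2; rewrite !itv0y => k10 k20 k12.
  by rewrite !profitW// ltr_pM2l//; exact: profit_decreasing.
- rewrite -(mulr0 (gamma * sigma / 2)).
  have h : (gamma * sigma / 2 * profit k) @[k --> +oo] --> gamma * sigma / 2 * 0.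
    by apply: cvgM; [exact: cvg_cst|exact: profit_cvg0].
  apply: (cvg_trans _ h); apply: near_eq_cvg; near=> k.
  by rewrite profitW//; near: k; exact: nbhs_pinfty_gt.
- move=> kappa kappa0; split; first exact: exists_noise_gain (hY _ kappa0).
  split; last by rewrite sub_sqr_Lambda.
  move=> I hI; rewrite EW//.
  rewrite (expected_noise_wealth hgamma hsigma kappa0 hV hB hVB (hY _ kappa0) hI).
  (* The noise traders' loss cancels the term [2 * Lambda kappa] of the profit. *)
  by rewrite -EFinD /profit; congr EFin; field.
Unshelve. all: by end_near. Qed.
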